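(* Let $Y$ be an irreducible sofic shift and let $f\colon Y \to \mathbb{R}$ be a potential with summable variation, that is, $f \in \mathrm{SV}(Y)$. Let $\nu$ be a $\sigma$-invariant Gibbs measure for $f$. Then $\nu$ is an equilibrium measure for $f$.
   Context: A shift space is a closed subset $X\subseteq \mathcal{A}^{\mathbb{Z}}$ ($\mathcal{A}$ a finite discrete alphabet, product topology) that is invariant under the shift $\sigma$, $(\sigma^n x)_0=x_n$. $\mathcal{B}(X)$ is the set of finite words appearing in points of $X$. A shift of finite type is a shift space consisting of all points of $\mathcal{A}^{\mathbb{Z}}$ in which no word from some finite set of forbidden words appears. A sofic shift is a shift space that is the image of a shift of finite type under a continuous shift-equivariant map. $X$ is irreducible if for all $u,v\in\mathcal{B}(X)$ there is $w\in\mathcal{B}(X)$ with $uwv\in\mathcal{B}(X)$. All measures are Borel probability measures. Gibbs relation: $\mathfrak{T}_X=\{(x,y)\in X\times X : x_n=y_n \text{ for all } n \text{ with } |n|>N, \text{ for some } N\ge 1\}$. A holonomy of $\mathfrak{T}_X$ is a Borel isomorphism $\psi\colon A\to B$ between Borel sets $A,B\subseteq X$ with $(x,\psi(x))\in\mathfrak{T}_X$ for all $x\in A$. A measure $\mu$ is $\mathfrak{T}_X$-nonsingular if for every Borel $A$ with $\mu(A)=0$, the saturation $\mathfrak{T}_X(A)=\{x' : \exists x\in A,\ (x,x')\in\mathfrak{T}_X\}$ has $\mu(\mathfrak{T}_X(A))=0$. A cocycle is a Borel function $\phi\colon\mathfrak{T}_X\to\mathbb{R}$ with $\phi(x,y)+\phi(y,z)=\phi(x,z)$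 whenever $(x,y),(y,z)\in\mathfrak{T}_X$. A measure $\mu$ on $X$ is a Gibbs measure for the cocycle $\phi$ if it is $\mathfrak{T}_X$-nonsingular and for every holonomy $\psi\colon A\to B$ of $\mathfrak{T}_X$, $\frac{d(\mu\circ\psi)}{d\mu}(x)=\exp(\phi(x,\psi(x)))$ for $\mu$-a.e. $x\in A$, where $(\mu\circ\psi)(E)=\mu(\psi(E))$ for Borel $E\subseteq A$. Potentials: for continuous $f\colon X\to\mathbb{R}$ put $v_k(f)=\sup\{|f(x)-f(y)| : x_{[-k,k]}=y_{[-k,k]}\}$ for $k\ge 0$ and $v_{-1}(f)=\|f\|_\infty$. $\mathrm{SV}(X)$ is the set of continuous $f$ with $\sum_{k=0}^\infty v_{k-1}(f)<\infty$. For $f\in\mathrm{SV}(X)$ the absolutely convergent series $\phi_f(x,y)=\sum_{n\in\mathbb{Z}}[f(\sigma^n y)-f(\sigma^n x)]$ defines a cocycle on $\mathfrak{T}_X$; a Gibbs measure for $f$ means a Gibbs measure for $\phi_f$. An equilibrium measure for a continuous $f\colon X\to\mathbb{R}$ is a $\sigma$-invariant measure $\mu$ on $X$ attaining the supremum $P_X(\sigma,f)=\sup\{h(\mu)+\int_X f\,d\mu\}$ over all $\sigma$-invariant measures on $X$, where $h(\mu)$ is the measure-theoretic (Kolmogorov–Sinai) entropy with respect to $\sigma$. *)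

(* Defs.v *)
From HB Require Import structures.
From mathcomp Require Import all_boot all_order all_algebra.
From mathcomp Require Import all_classical all_reals all_analysis.
From mathcomp Require Import measurable_realfun.

Set Implicit Arguments.
Unset Strict Implicit.
Unset Printing Implicit Defensive.

Import Order.TTheory GRing.Theory Num.Theory.
Import numFieldNormedType.Exports.

Local Open Scope classical_set_scope.
Local Open Scope ring_scope.

(* Nonempty finite alphabets: measurable types are pointed in the library. *)
#[short(type="pointedFinType")]
HB.structure Definition PointedFinite := {A of Finite A & Pointed A}.

(* The full shift A^Z, with the product of the discrete topologies and the
   Borel sigma-algebra. *)
Definition config (A : Type) : Type := int -> A.

HB.instance Definition _ (A : choiceType) :=
  Topological.copy (config A) {ptws int -> discrete_topology A}.
HB.instance Definition _ (A : pointedType) :=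
  isPointed.Build (config A) (fun=> point).
HB.instance Definition _ (A : pointedType) :=
  @isMeasurable.Build (sigma_display (@open (config A))) (config A)
    <<s @open (config A) >> (@sigma_algebra0 _ setT _) (@sigma_algebraC _ _)
    (@sigma_algebra_bigcup _ setT _).

(* [shift_map n] is sigma^n; the name [shift] is taken by the library. *)
Definition shift_map (A : Type) (n : int) (x : config A) : config A :=
  fun i => x (i + n).

Definition shift_space (A : choiceType) (X : set (config A)) : Prop :=
  closed X /\ forall n x, X x -> X (shift_map n x).

Definition appears (A : Type) (w : seq A) (x : config A) : Prop :=
  exists i : int, w = mkseq (fun j => x (i + j%:Z)) (size w).

Definition language (A : Type) (X : set (config A)) : set (seq A) :=
  [set w | exists2 x, X x & appears w x].

Definition shift_of_finite_type (A : choiceType) (X : set (config A)) : Prop :=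
  exists F : seq (seq A),
    X = [set x | forall w, w \in F -> ~ appears w x].

Definition sofic (A : choiceType) (Y : set (config A)) : Prop :=
  shift_space Y /\
  exists (B : finType) (X : set (config B)) (p : config B -> config A),
    [/\ shift_of_finite_type X,
        {within X, continuous p},
        forall n x, X x -> p (shift_map n x) = shift_map n (p x) &
        p @` X = Y].

Definition irreducible (A : Type) (X : set (config A)) : Prop :=
  forall u v, language X u -> language X v ->
  exists2 w, language X w & language X (u ++ w ++ v).

Definition gibbs_rel (A : Type) (X : set (config A)) (x y : config A) : Prop :=
  [/\ X x, X y &
      exists2 N : nat, (1 <= N)%N &
        forall n : int, (N < absz n)%N -> x n = y n].

Definition saturation (A : Type) (X E : set (config A)) : set (config A) :=
  [set y | exists2 x, E x & gibbs_rel X x y].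

(* A map between subsets is represented by a total function, whose values
   outside its domain are irrelevant. *)
Definition holonomy (A : pointedType) (X D E : set (config A))
    (psi : config A -> config A) : Prop :=
  [/\ measurable D /\ D `<=` X, measurable E /\ E `<=` X,
      set_bij D E psi /\ measurable_fun D psi,
      exists psi' : config A -> config A,
        (forall x, D x -> psi' (psi x) = x) /\ measurable_fun E psi' &
      forall x, D x -> gibbs_rel X x (psi x)].

(* [mu] is a Borel probability measure on X, identified with a Borel
   probability measure on the full shift that gives full mass to X. *)
Definition measure_on (R : realType) (A : pointedType) (X : set (config A))
    (mu : probability (config A) R) : Prop :=
  mu X = 1%E.

Definition shift_invariant (R : realType) (A : pointedType)
    (mu : probability (config A) R) : Prop :=
  forall E : set (config A), measurable E -> mu (shift_map 1 @^-1` E) = mu E.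

Definition nonsingular (R : realType) (A : pointedType) (X : set (config A))
    (mu : probability (config A) R) : Prop :=
  forall E : set (config A), measurable E -> E `<=` X ->
    mu E = 0%E -> mu (saturation X E) = 0%E.

(* [g] is a version of the Radon-Nikodym derivative d lambda / d mu on D,
   for a set function [lambda] on the measurable subsets of D. *)
Definition RN_derivative d (T : measurableType d) (R : realType)
    (mu : {measure set T -> \bar R}) (D : set T) (lambda : set T -> \bar R)
    (g : T -> \bar R) : Prop :=
  [/\ measurable_fun D g, forall x, D x -> (0 <= g x)%E &
      forall E, measurable E -> E `<=` D ->
        lambda E = (\int[mu]_(x in E) g x)%E].

Definition gibbs_measure (R : realType) (A : pointedType)
    (X : set (config A)) (phi : config A -> config A -> R)
    (mu : probability (config A) R) : Prop :=
  [/\ measure_on X mu, nonsingular X mu &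
      forall D E psi, holonomy X D E psi ->
        exists2 g : config A -> \bar R,
          RN_derivative mu D (fun F => mu (psi @` F)) g &
          {ae mu, forall x, D x -> g x = (expR (phi x (psi x)))%:E}].

(* v_k for k >= 0, and v_{-1} = the sup norm on X. *)
Definition variation (R : realType) (A : Type) (X : set (config A))
    (f : config A -> R) (k : int) : \bar R :=
  match k with
  | Posz k' =>
      ereal_sup [set z | exists x y, [/\ X x, X y,
        forall n : int, (absz n <= k')%N -> x n = y n &
        z = (`|f x - f y|)%:E]]
  | Negz _ => ereal_sup [set (`|f x|)%:E | x in X]
  end.

Definition summable_variation (R : realType) (A : choiceType)
    (X : set (config A)) (f : config A -> R) : Prop :=
  {within X, continuous f} /\
  (\sum_(0 <= k <oo) variation X f (k%:Z - 1) < +oo)%E.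

(* The bilateral series is the limit of its symmetric partial sums. *)
Definition potential_cocycle (R : realType) (A : Type) (f : config A -> R)
    (x y : config A) : R :=
  limn (fun N : nat => \sum_(0 <= i < N.*2.+1)
    (f (shift_map (i%:Z - N%:Z) y) - f (shift_map (i%:Z - N%:Z) x))).

Definition measurable_partition d (T : measurableType d) (k : nat)
    (P : 'I_k -> set T) : Prop :=
  (forall i, measurable (P i)) /\ partition setT P setT.

(* Shannon entropy of the join of t^-i P for i < n; its atoms are indexed by
   itineraries, the empty ones contributing 0, and 0 * ln 0 = 0. *)
Definition join_entropy d (T : measurableType d) (R : realType)
    (mu : probability T R) (t : T -> T) (k : nat) (P : 'I_k -> set T)
    (n : nat) : R :=
  \sum_(w : {ffun 'I_n -> 'I_k})
    let p := fine (mu [set x | forall i : 'I_n, P (w i) (iter i t x)]) in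
    - (p * ln p).

Definition partition_entropy d (T : measurableType d) (R : realType)
    (mu : probability T R) (t : T -> T) (k : nat) (P : 'I_k -> set T) : R :=
  limn (fun n : nat => n%:R^-1 * join_entropy mu t P n).

(* Kolmogorov-Sinai entropy of the measure-preserving transformation t. *)
Definition ks_entropy d (T : measurableType d) (R : realType)
    (mu : probability T R) (t : T -> T) : \bar R :=
  ereal_sup [set h | exists (k : nat) (P : 'I_k -> set T),
    measurable_partition P /\ h = (partition_entropy mu t P)%:E].

Definition free_energy (R : realType) (A : pointedType) (X : set (config A))
    (f : config A -> R) (mu : probability (config A) R) : \bar R :=
  (ks_entropy mu (shift_map 1) + \int[mu]_(x in X) (f x)%:E)%E.

Definition pressure (R : realType) (A : pointedType) (X : set (config A))
    (f : config A -> R) : \bar R :=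
  ereal_sup [set free_energy X f mu | mu in
    [set mu : probability (config A) R | measure_on X mu /\ shift_invariant mu]].

Definition equilibrium_measure (R : realType) (A : pointedType)
    (X : set (config A)) (f : config A -> R)
    (mu : probability (config A) R) : Prop :=
  [/\ measure_on X mu, shift_invariant mu & free_energy X f mu = pressure X f].

(* Main.v *)
Require Import Defs.
From mathcomp Require Import all_boot all_order all_algebra.
From mathcomp Require Import all_classical all_reals all_analysis.
From mathcomp Require Import measurable_realfun zify ring lra.

(* Choose for each word u of length n occurring in Y a point of Y carrying u on
   [0, n[, let E(u) be the Birkhoff sum of f at that point, and let Z_n be the
   sum of the exp E(u).  Summability of the variations makes E(u) independent of
   the choice up to O(1), so that ln Z_n is subadditive up to O(1) and
   ln Z_n / n converges to some p.

   Lower bound.  In a sofic irreducible shift any word v of length n can be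
   inserted in any point of Y by changing only the coordinates in [-L, n + L[,
   with L independent of n, v and the point (up to a displacement of v by at
   most L).  Such exchanges of finite blocks are holonomies, whose cocycle is
   E(v) - E(u) + O(1); hence nu[u] exp E(v) <= C exp E(u) nu[v], and summing over
   v gives nu[u] Z_n <= C exp E(u).  So the entropy of nu with respect to the
   partition by the coordinate 0 is at least p - int f dnu.

   Upper bound.  Let mu be invariant and P a finite measurable partition.  Up to
   an error of mu-measure e, P is read off the coordinates in [-N, N].  Gibbs'
   inequality applied to the law of the pair (P-itinerary of length n, word on
   [-N, n + N[) and to suitable product weights bounds the entropy of the
   itinerary by ln Z_n - n int f dmu + n O(e ln 1/e) + O(1), so the free energy
   of mu is at most p. *)

Set Implicit Arguments.
Unset Strict Implicit.
Unset Printing Implicit Defensive.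

Import Order.TTheory GRing.Theory Num.Theory.
Import numFieldNormedType.Exports.

Local Open Scope classical_set_scope.
Local Open Scope ring_scope.

(** * The topology of A^Z *)

Section Topology.
Context {A : choiceType}.
Implicit Types (x y : config A) (U : set (config A)).

Definition agree (B : Type) (N : nat) (x y : config B) : Prop :=
  forall n : int, (absz n <= N)%N -> x n = y n.

Definition window_filter (x : config A) : set_system (config A) :=
  filter_from [set: nat] (fun N => [set y | agree N x y]).

Lemma window_filter_filter x : Filter (window_filter x).
Proof.
apply: filter_from_filter; first by exists 0%N.
move=> i j _ _; exists (maxn i j) => // y xy; split=> n ni; apply: xy; lia.
Qed.

(** The product topology is a supremum of topologies pulled back along the coordinates, so
    convergence is checked at one coordinate i at a time, and a window of radius |i| already fixes
    the value there. *)
Lemma window_filter_cvg x : window_filter x --> x.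
Proof.
have FF := window_filter_filter x.
apply/cvg_sup => i V; rewrite nbhsE => -[W [ [Q oQ QW] Wx] WV].
exists (absz i) => // y xy; apply: WV; rewrite -QW /=.
by rewrite -(xy i) //; move: Wx; rewrite -QW.
Qed.

Lemma coord_open (i : int) (a : A) : open [set x : config A | x i = a].
Proof.
have pc : continuous ((fun x => x i) : config A -> discrete_topology A).
  exact: (@proj_continuous int (fun=> discrete_topology A) i).
by move/continuousP: pc => /(_ [set a]); apply; exact: discrete_open.
Qed.

Lemma open_window x N : open [set y | agree N x y].
Proof.
pose F (i : nat) := [set y : config A | y (i%:Z - N%:Z) = x (i%:Z - N%:Z)].
have -> : [set y | agree N x y] = \bigcap_(i < N.*2.+1) F i.
  apply/seteqP; split=> [y xy i /= iN|y yF n nN].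
    by rewrite /F /= xy //; lia.
  have := yF (absz (n + N%:Z)); rewrite /F /=.
  have -> : ((absz (n + N%:Z)) : int) - N%:Z = n by lia.
  by move=> -> //; lia.
rewrite bigcap_mkord; elim/big_ind: _ => [|V W oV oW|i _].
- exact: openT.
- exact: openI.
- exact: coord_open.
Qed.

Lemma open_agreeP U :
  open U <-> forall x, U x -> exists N, forall y, agree N x y -> U y.
Proof.
split=> [oU x Ux|h].
  have [N _ NU] : window_filter x U.
    by apply: window_filter_cvg; exact: open_nbhs_nbhs.
  by exists N.
rewrite openE => x /h[N NU]; rewrite /interior.
apply: filterS NU _; apply: open_nbhs_nbhs; split; first exact: open_window.
by [].
Qed.

Lemma closed_agree U x : closed U ->
  (forall N, exists2 y, U y & agree N x y) -> U x.
Proof.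
move=> /closed_openC/open_agreeP cU h; apply: contrapT => /cU[N xN].
by have [y Uy /xN] := h N.
Qed.

Lemma within_continuous_agree (T : topologicalType) (X : set (config A))
    (g : config A -> T) (V : set T) x :
  {within X, continuous g} -> open V -> X x -> V (g x) ->
  exists N, forall y, X y -> agree N x y -> V (g y).
Proof.
move=> /continuousP/(_ V) gV oV Xx Vx.
have /open_subspaceP[W oW WX] := gV oV.
have Wx : W x.
  have : (W `&` X) x by rewrite WX.
  by case.
have [N NW] := (open_agreeP W).1 oW x Wx.
exists N => y Xy /NW Wy.
by have : (W `&` X) y by []; rewrite WX => -[].
Qed.

Lemma config_compact : finite_set [set: A] -> compact [set: config A].
Proof.
move=> fA.
have := @tychonoff int (fun=> discrete_topology A) (fun=> setT)
  (fun=> @finite_compact (discrete_topology A) setT fA).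
by congr (@compact _ _); apply/seteqP; split.
Qed.

End Topology.

(* Curtis-Hedlund-Lyndon *)
Lemma within_continuous_uniform (B : finType) (A : choiceType)
    (X : set (config B)) (p : config B -> config A) :
  closed X -> {within X, continuous p} ->
  exists k, forall x y, X x -> X y -> agree k x y -> p x 0 = p y 0.
Proof.
move=> cX cp.
have cptX : compact X.
  apply: (subclosed_compact cX (config_compact _)) => //.
  exact/finite_finset.
pose P N x := X x -> forall y, X y -> agree N x y -> p x 0 = p y 0.
(* Compactness in its near-covering form: [P N] holds near each point of X for all large N, so a
   single N serves all of X. *)
have /compact_near_coveringP/near_covering_withinP/(_ nat \oo P) := cptX.
case=> [|N _ NP]; last first.
  by exists N => x y Xx Xy; exact: (NP N (leqnn N) x Xx Xx y Xy).
move=> x Xx.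
have [N NP] := @within_continuous_agree B _ X p [set z | z 0 = p x 0] x cp
  (coord_open _ _) Xx erefl.
exists ([set y | agree N x y], [set n | (N <= n)%N]) => /=.
  split; last by exists N.
  by apply: open_nbhs_nbhs; split; [exact: open_window|].
case=> y n [/= xy Nn] Xy _ z Xz yz.
rewrite (NP y Xy xy) (NP z Xz) // => i iN.
by rewrite xy // yz // (leq_trans iN).
Qed.

(** * Inserting words in sofic shifts *)

Lemma eq_mkseq_lt (T : Type) (f g : nat -> T) n :
  (forall j, (j < n)%N -> f j = g j) -> mkseq f n = mkseq g n.
Proof.
by move=> fg; elim: n fg => // n IH fg; rewrite !mkseqS fg // IH // => j /ltnW/fg.
Qed.

Definition subword (T : Type) (x : int -> T) (i : int) (n : nat) : seq T :=
  mkseq (fun j => x (i + j%:Z)) n.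

Lemma size_subword (T : Type) (x : int -> T) i n : size (subword x i n) = n.
Proof. exact: size_mkseq. Qed.

Lemma eq_subword (T : Type) (x y : int -> T) i j n :
  (forall k, (k < n)%N -> x (i + k%:Z) = y (j + k%:Z)) ->
  subword x i n = subword y j n.
Proof. exact: eq_mkseq_lt. Qed.

Lemma subwordD (T : Type) (x : int -> T) i m n :
  subword x i (m + n) = subword x i m ++ subword x (i + m%:Z) n.
Proof.
rewrite /subword /mkseq iotaD map_cat; congr (_ ++ _).
rewrite add0n -[X in iota X]addn0 iotaDl -map_comp; apply: eq_map => j /=.
by rewrite -addrA.
Qed.

Lemma appearsP (T : Type) (w : seq T) (x : config T) :
  appears w x <-> exists i, w = subword x i (size w).
Proof. by []. Qed.

Lemma appears_subword (T : Type) (x : config T) i n : appears (subword x i n) x.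
Proof. by apply/appearsP; exists i; rewrite size_subword. Qed.

Lemma appears_shift (T : Type) (w : seq T) (x : config T) n :
  appears w (shift_map n x) -> appears w x.
Proof.
move=> /appearsP[i ->]; rewrite /subword; set m := size w.
apply/appearsP; exists (i + n); rewrite size_mkseq.
by apply: eq_mkseq => j; rewrite /shift_map; congr (x _); lia.
Qed.

Definition splice (T : Type) (i : int) (x y : int -> T) : int -> T :=
  fun l => if l < i then x l else y l.

(** * Shifts of finite type *)

Section ShiftOfFiniteType.
Context {B : choiceType} (F : seq (seq B)).
Let X := [set x : config B | forall w, w \in F -> ~ appears w x].

Lemma sft_closed : closed X.
Proof.
rewrite -[X]setCK; apply: open_closedC; apply/open_agreeP => x.
move=> /existsNP[w /not_implyP[wF /contrapT/appearsP[i wE]]].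
exists (absz i + size w)%N => y xy /(_ w wF); apply.
apply/appearsP; exists i; rewrite {1}wE; apply: eq_subword => k kw.
apply: xy; lia.
Qed.

Lemma sft_shift x n : X x -> X (shift_map n x).
Proof. by move=> Xx w /Xx wx /appears_shift. Qed.

(** An occurrence that ends by i + M reads x, because x and y agree on [i, i + M[; one that ends
    later starts after i, its length being at most M, and reads y. *)
Lemma sft_splice M x y i : (forall w, w \in F -> (size w <= M)%N) ->
  X x -> X y -> (forall j : int, (absz j <= M)%N -> x (i + j) = y (i + j)) ->
  X (splice i x y).
Proof.
move=> FM Xx Xy xy w wF /appearsP[a wE].
have wM := FM w wF.
have [aw|aw] := leP (a + (size w)%:Z) (i + M%:Z).
  apply: (Xx w wF); apply/appearsP; exists a; rewrite {1}wE.
  apply: eq_subword => k kw; rewrite /splice; case: ltP => // ik.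
  have := xy (a + k%:Z - i); have -> : i + (a + k%:Z - i) = a + k%:Z by lia.
  by move=> -> //; lia.
apply: (Xy w wF); apply/appearsP; exists a; rewrite {1}wE.
apply: eq_subword => k kw; rewrite /splice; case: ltP => // ik.
lia.
Qed.

End ShiftOfFiniteType.

(** * Labelled graphs presenting a sofic shift *)

Section Presentations.

(* A labelled graph with vertex set S, given by its bi-infinite walks: [P y s]
   means that y is the label sequence of a walk visiting s i at time i.  The
   second property says that a walk may be switched whenever vertices meet. *)
Definition presentation (A S : Type) (Y : set (config A))
    (P : config A -> config S -> Prop) : Prop :=
  [/\ forall a y s, P y s -> P (shift_map a y) (shift_map a s),
      forall i y s y' s', P y s -> P y' s' -> s i = s' i ->
        P (splice i y y') (splice i s s') &
      forall y, Y y <-> exists s, P y s].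

(** The vertices are words of length 2M + 1 over the alphabet of the covering shift of finite type.
    M bounds the lengths of the forbidden words, so that points meeting at a vertex can be spliced,
    and also the memory k of the factor map, so that the vertex determines the label. *)
Lemma sofic_presentation (A : choiceType) (Y : set (config A)) : sofic Y ->
  exists (S : finType) (P : config A -> config S -> Prop), presentation Y P.
Proof.
case=> _ [B] [X] [p] [[F ->]]; set Xs := [set x | _] => cp ps pX.
have [k kP] := within_continuous_uniform (@sft_closed B F) cp.
pose M := maxn k (\max_(w <- F) size w).
have FM w : w \in F -> (size w <= M)%N.
  by move=> wF; rewrite leq_max leq_bigmax_seq ?orbT.
pose st (x : config B) (i : int) : {ffun 'I_(M.*2.+1) -> B} :=
  [ffun j : 'I_(M.*2.+1) => x (i + (j%:Z - M%:Z))].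
have stP x y i j : st x i = st y j <->
    forall n : int, (absz n <= M)%N -> x (i + n) = y (j + n).
  split=> [/ffunP e n nM|e].
    have lt : (absz (n + M%:Z)%R < M.*2.+1)%N by lia.
    move: (e (Ordinal lt)); rewrite !ffunE /=.
    by have -> : (absz (n + M%:Z)%R)%:Z - M%:Z = n by lia.
  by apply/ffunP => l; rewrite !ffunE e //; have := ltn_ord l; lia.
have pl x y i : Xs x -> Xs y ->
    (forall n : int, (absz n <= M)%N -> x (i + n) = y (i + n)) ->
    p x i = p y i.
  move=> Xx Xy xy.
  have e z : Xs z -> p z i = p (shift_map i z) 0.
    by move=> Xz; rewrite ps // /shift_map add0r.
  rewrite !e //; apply: kP; [exact: sft_shift|exact: sft_shift|].
  move=> n nk; rewrite /shift_map addrC xy ?[i + n]addrC //.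
  by rewrite (leq_trans nk) // leq_maxl.
exists {ffun 'I_(M.*2.+1) -> B}.
exists (fun y s => exists2 x, Xs x & y = p x /\ s = st x); split.
- move=> a y s [x Xx [-> ->]]; exists (shift_map a x); first exact: sft_shift.
  split; first by rewrite ps.
  apply/funext => i; apply/ffunP => l; rewrite !ffunE /shift_map.
  by congr (x _); lia.
- move=> i y s y' s' [x Xx [-> ->]] [x' Xx' [-> ->]] /stP xx'.
  have Xz := sft_splice FM Xx Xx' xx'.
  have zx l (n : int) : l < i -> (absz n <= M)%N ->
      splice i x x' (l + n) = x (l + n).
    move=> li nM; rewrite /splice; case: ltP => // iln.
    have := xx' (l + n - i); have -> : i + (l + n - i) = l + n by lia.
    by move=> -> //; lia.
  have zx' l (n : int) : i <= l -> (absz n <= M)%N ->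
      splice i x x' (l + n) = x' (l + n).
    move=> li nM; rewrite /splice; case: ltP => // iln.
    have := xx' (l + n - i); have -> : i + (l + n - i) = l + n by lia.
    by move=> -> //; lia.
  exists (splice i x x') => //; split; apply/funext => l; rewrite {1}/splice.
    case: ltP => li; apply: pl => // n nM; first by rewrite -zx.
    by rewrite -zx'.
  case: ltP => li; apply/stP => n nM; first by rewrite -zx.
  by rewrite -zx'.
- move=> y; rewrite -pX; split=> [[x Xx <-]|[s [x Xx [-> _]]]].
    by exists (st x); exists x.
  by exists x.
Qed.

Context {A : Type} {S : finType} {Y : set (config A)}.
Context {P : config A -> config S -> Prop} (HP : presentation Y P).

Definition walk (a b : S) (w : seq A) : Prop :=
  exists y s, [/\ P y s, s 0 = a, s (size w)%:Z = b & w = subword y 0 (size w)].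

Definition reach (a b : S) : Prop := exists w, walk a b w.

Lemma walk_subword y s (i j : int) (n : nat) : P y s -> j = i + n%:Z ->
  walk (s i) (s j) (subword y i n).
Proof.
case: HP => sh _ _ Pys ->; exists (shift_map i y), (shift_map i s).
rewrite size_subword /shift_map add0r [n%:Z + i]addrC; split => //.
  exact: sh.
by apply: eq_subword => k kn; congr (y _); lia.
Qed.

Lemma walk_cat a b c u v : walk a b u -> walk b c v -> walk a c (u ++ v).
Proof.
case: (HP) => sh sp _ [y [s [Pys sa sb uE]]] [y' [s' [Pys' s'b s'c vE]]].
set i := (size u)%:Z.
have := sp i y s (shift_map (- i) y') (shift_map (- i) s') Pys (sh _ _ _ Pys').
rewrite /shift_map subrr s'b => /(_ sb) Pz.
have {1}-> : u = subword (splice i y (shift_map (- i) y')) 0 (size u).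
  rewrite {1}uE; apply: eq_subword => k ku; rewrite /splice.
  by case: ltP => // ?; lia.
have {1}-> : v = subword (splice i y (shift_map (- i) y')) i (size v).
  rewrite {1}vE; apply: eq_subword => k ku; rewrite /splice /shift_map.
  case: ltP => [|_]; first lia.
  by congr (y' _); lia.
rewrite -{2}[i]add0r -subwordD.
(* If u is empty, the splice already follows the second walk at time 0; the two walks meet there. *)
have <- : splice i s (shift_map (- i) s') 0 = a.
  rewrite /splice /shift_map; case: ltP => //; rewrite /i => u0.
  have u00 : size u = 0%N by lia.
  by rewrite -sa u00 subr0 s'b -sb /i u00.
have <- : splice i s (shift_map (- i) s') (size u + size v)%N = c.
  rewrite /splice /shift_map; case: ltP => [|_]; first by rewrite /i; lia.
  by rewrite -s'c; congr (s' _); rewrite /i; lia.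
by apply: walk_subword => //; rewrite add0r.
Qed.

Lemma walk_split a b u v : walk a b (u ++ v) ->
  exists2 c, walk a c u & walk c b v.
Proof.
case=> y [s [Pys sa sb]]; rewrite size_cat subwordD add0r => uv.
exists (s (size u)%:Z).
  have -> : u = subword y 0 (size u).
    have := congr1 (take (size u)) uv.
    by rewrite take_size_cat // take_size_cat // size_subword.
  by rewrite size_subword -sa; apply: walk_subword; rewrite ?add0r.
have -> : v = subword y (size u)%:Z (size v).
  have := congr1 (drop (size u)) uv.
  by rewrite drop_size_cat // drop_size_cat // size_subword.
by rewrite -sb size_cat; apply: walk_subword => //; lia.
Qed.

Lemma languageP w : language Y w <-> exists a b, walk a b w.
Proof.
case: (HP) => sh _ YP; split=> [[y /YP[s Pys] /appearsP[i ->]]|].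
  by exists (s i), (s (i + (size w)%:Z)); exact: walk_subword.
case=> a [b [y [s [Pys _ _ ->]]]]; exists y; last exact: appears_subword.
by apply/YP; exists s.
Qed.

Lemma reach_trans a b c : reach a b -> reach b c -> reach a c.
Proof. by move=> [u ab] [v bc]; exists (u ++ v); exact: walk_cat ab bc. Qed.

Lemma language_cat u v : language Y (u ++ v) -> language Y u /\ language Y v.
Proof.
move=> /languageP[a [b /walk_split[c ac cb]]].
by split; apply/languageP; [exists a, c|exists c, b].
Qed.

(** The walk extends to a closed walk through c, so it stays in the strongly connected component of
    c. *)
Definition in_component (c : S) (w : seq A) : Prop :=
  exists a b, [/\ walk a b w, reach c a & reach b c].

Lemma in_component_mid c u v w : in_component c (u ++ v ++ w) -> in_component c v.
Proof.
case=> a [b [/walk_split[a' aa' /walk_split[b' a'b' b'b]] ca bc]].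
exists a', b'; split => //.
  by apply: reach_trans ca _; exists u.
by apply: reach_trans bc; exists w.
Qed.

(* If every component misses some word, a word w containing all the missed
   words labels no walk inside a component; but |S| + 1 copies of w cannot all
   be read without revisiting a vertex in between. *)
Lemma irreducible_component : irreducible Y -> Y !=set0 ->
  exists c, forall w, language Y w -> in_component c w.
Proof.
move=> irrY [y0 Yy0]; apply: contrapT => noc.
have nil_lang : language Y [::].
  by exists y0 => //; apply/appearsP; exists 0.
have bad c : exists w, language Y w /\ ~ in_component c w.
  apply: contrapT => nw; apply: noc; exists c => w Lw; apply: contrapT => ncw.
  by apply: nw; exists w.
have [w [Lw ncw]] : exists w, language Y w /\ forall c, ~ in_component c w.
  suff [w [Lw ncw]] : exists w, language Y w /\
      forall c, c \in enum S -> ~ in_component c w.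
    by exists w; split => // c; apply: ncw; rewrite mem_enum.
  elim: (enum S) => [|c cs [w [Lw wcs]]]; first by exists [::].
  have [v [Lv ncv]] := bad c; have [z _ Lvzw] := irrY v w Lv Lw.
  exists (v ++ z ++ w); split => // d; rewrite inE => /orP[/eqP ->|dcs].
    by rewrite -[v ++ _]cat0s => /in_component_mid.
  by rewrite -[w]cats0 catA => /in_component_mid; exact: wcs.
pose copies := fix copies n z : Prop :=
  if n is n'.+1 then exists g z', z = w ++ g ++ z' /\ copies n' z' else True.
have [z [Lz cz]] : exists z, language Y z /\ copies #|S|.+1 z.
  elim: #|S|.+1 => [|n [z [Lz cz]]]; first by exists [::].
  have [g _ Lg] := irrY w z Lw Lz.
  by exists (w ++ g ++ z); split => //; exists g, z.
have [a [b ab]] := (languageP z).1 Lz.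
(* D collects the vertices at which earlier copies of w began; from each of them some walk whose
   label starts with w leads to the current vertex a'. If a' is in D, this closes a loop reading w;
   otherwise D grows, and it cannot exceed S. *)
have stuck n (D : {set S}) a' z' : (#|S| < #|D| + n)%N -> copies n z' ->
    walk a' b z' -> (forall d, d \in D -> exists v, walk d a' (w ++ v)) -> False.
  elim: n D a' z' => [|n IH] D a' z' Dn; first by rewrite addn0 ltnNge max_card in Dn.
  case=> g [z'' [-> cz'']]; rewrite catA => /walk_split[a'' a'a'' a''b] Da'.
  have [a'D|a'D] := boolP (a' \in D).
    have [v a'v] := Da' _ a'D; apply: (ncw a').
    apply: (@in_component_mid _ [::] w v).
    by exists a', a'; split; [|exists (w ++ v)|exists (w ++ v)].
  apply: (IH (a' |: D) a'' z'') => //; first by rewrite cardsU1 a'D; lia.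
  move=> d; rewrite in_setU1 => /orP[/eqP ->|dD]; first by exists g.
  have [v dv] := Da' _ dD; exists (v ++ w ++ g).
  by rewrite catA; exact: walk_cat dv a'a''.
by apply: (stuck #|S|.+1 finset.set0 a z) => // [|d]; rewrite ?finset.cards0 ?finset.inE.
Qed.

(* The residues modulo q of the lengths of loops at a vertex are closed under
   addition, hence under subtraction; so any admissible residue is realized by
   a loop of bounded length, and the rest is filled with a loop of length q. *)
Lemma adjusted_reach : exists L, forall a b a' b' u v,
  reach a a' -> reach b' b -> reach b a ->
  walk a b u -> walk a' b' v -> size u = (size v + L.*2)%N ->
  exists w1 w2, [/\ walk a a' w1, walk b' b w2 & (size w1 + size w2 = L.*2)%N].
Proof.
have /choice[con conP] : forall p : S * S, exists w,
    reach p.1 p.2 -> walk p.1 p.2 w.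
  move=> p; have [[w wP]|np] := pselect (reach p.1 p.2); first by exists w.
  by exists [::] => /np.
have /choice[lp lpP] : forall a, exists w,
    (exists2 w, walk a a w & (0 < size w)%N) ->
    walk a a w /\ (0 < size w)%N.
  move=> a.
  have [[w wP w0]|nw] := pselect (exists2 w, walk a a w & (0 < size w)%N).
    by exists w.
  by exists [::] => /nw.
pose Q := \max_(a : S) size (lp a).
(* One finite index type serves all vertices: every loop [lp a] has length at most Q, so ['I_Q.+1]
   contains all residues modulo that length. *)
have /choice[rep repP] : forall p : S * 'I_Q.+1, exists w,
    (exists2 w, walk p.1 p.1 w & size w = p.2 %[mod size (lp p.1)]) ->
    walk p.1 p.1 w /\ size w = p.2 %[mod size (lp p.1)].
  move=> p; have [[w wP w0]|nw] := pselect
    (exists2 w, walk p.1 p.1 w & size w = p.2 %[mod size (lp p.1)]).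
    by exists w.
  by exists [::] => /nw.
pose K1 := \max_p size (con p); pose K2 := \max_p size (rep p).
(* Two connecting words of length at most K1 must leave room, within 2L, for a loop of length at
   most K2. *)
exists (K1 + K2).+1 => a b a' b' u v aa' b'b ba ab a'b' uv.
have conK p : (size (con p) <= K1)%N by rewrite /K1 (leq_bigmax p).
have /= wal := conP (a, a') aa'; have /= wbe := conP (b', b) b'b.
have /= wga := conP (b, a) ba.
move: (conK (a, a')) (conK (b', b)) => Kal Kbe.
set al := con _ in wal Kal *; set be := con _ in wbe Kbe *.
set ga := con _ in wga *.
have l1 : walk a a (u ++ ga) by exact: walk_cat ab wga.
have l2 : walk a a (al ++ v ++ be ++ ga).
  exact: walk_cat wal (walk_cat a'b' (walk_cat wbe wga)).
have [lpa lpa0] : walk a a (lp a) /\ (0 < size (lp a))%N.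
  by apply: lpP; exists (u ++ ga) => //; rewrite size_cat uv; lia.
set q := size (lp a) in lpa0 *.
pose pow w k : seq A := iter k (cat w) [::].
have powP w k : walk a a w -> walk a a (pow w k).
  move=> ww; elim: k => [|k IH] /=; last exact: walk_cat ww IH.
  have [c wc _] : exists2 c, walk a c [::] & walk c a w by exact: walk_split.
  by case: wc => y [s [Pys sa _ _]]; exists y, s.
have size_pow w k : size (pow w k) = (k * size w)%N.
  by elim: k => //= k IH; rewrite size_cat IH mulSn.
(* Modulo q, q - 1 copies of the loop through v count as minus one copy. As |u| = |v| + 2L, this
   makes X congruent to 2L - |al| - |be|, the length still to be filled, although X is the length of
   an actual loop at a. *)
pose X := (size (u ++ ga) + q.-1 * size (al ++ v ++ be ++ ga))%N.
have hQ : (X %% q < Q.+1)%N.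
  by rewrite ltnS (leq_trans (ltnW (ltn_pmod _ lpa0))) // /q /Q (leq_bigmax a).
have [|/= wr rX] := repP (a, Ordinal hQ).
  exists ((u ++ ga) ++ pow (al ++ v ++ be ++ ga) q.-1).
    exact: walk_cat l1 (powP _ q.-1 l2).
  by rewrite size_cat size_pow /= modn_mod.
have : (size (rep (a, Ordinal hQ)) <= K2)%N by rewrite /K2 (leq_bigmax (a, Ordinal hQ)).
set r := rep _ in wr rX * => rK; rewrite -/q modn_mod in rX.
pose d := ((K1 + K2).+1.*2 - size al - size be)%N.
have dX : d = size r %[mod q].
  rewrite rX; set l := size (al ++ v ++ be ++ ga).
  have -> : X = (l * q + d)%N; last by rewrite modnMDl.
  have -> : X = (d + l + q.-1 * l)%N.
    by congr (_ + _)%N; rewrite /l !size_cat uv /d; lia.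
  by rewrite -[in RHS](prednK lpa0) mulnS; lia.
have rd : (size r <= d)%N by rewrite /d; lia.
exists (r ++ pow (lp a) ((d - size r) %/ q)%N ++ al), be; split => //.
  exact: walk_cat wr (walk_cat (powP _ _ lpa) wal).
have qd : (q %| d - size r)%N by rewrite -eqn_mod_dvd //; apply/eqP.
rewrite !size_cat size_pow -/q divnK // /d; rewrite /d in rd; lia.
Qed.

(** Both words label walks inside one strongly connected component, where [adjusted_reach] replaces
    the walk reading u by a detour through v of the same length. *)
Lemma insert_word : irreducible Y -> Y !=set0 ->
  exists L, forall x u y v, language Y (x ++ u ++ y) -> language Y v ->
    size u = (size v + L.*2)%N ->
  exists w1 w2, language Y (x ++ w1 ++ v ++ w2 ++ y) /\
    (size w1 + size w2 = L.*2)%N.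
Proof.
move=> irrY Y0; have [c cP] := irreducible_component irrY Y0.
have [L LP] := adjusted_reach; exists L => x u y v Lxuy Lv uv.
have [a [b [/walk_split[a' aa' /walk_split[b' a'b' b'b]] ca bc]]] := cP _ Lxuy.
have [s [t [st cs tc]]] := cP _ Lv.
have rw d e w : walk d e w -> reach d e by exists w.
have [|||w1 [w2 [W1 W2 w12]]] := LP a' b' s t u v _ _ _ a'b' st uv.
- exact: reach_trans (rw _ _ _ a'b') (reach_trans (rw _ _ _ b'b) (reach_trans bc cs)).
- exact: reach_trans tc (reach_trans ca (reach_trans (rw _ _ _ aa') (rw _ _ _ a'b'))).
- exact: reach_trans (rw _ _ _ b'b) (reach_trans bc (reach_trans ca (rw _ _ _ aa'))).
exists w1, w2; split => //; apply/languageP; exists a, b.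
exact: walk_cat aa' (walk_cat W1 (walk_cat st (walk_cat W2 b'b))).
Qed.

End Presentations.

(** * Words at given positions and overwriting of blocks *)

Section Words.
Context {A : Type}.
Implicit Types (x y : config A).

Definition word (a : int) (m : nat) x : {ffun 'I_m -> A} :=
  [ffun i : 'I_m => x (a + i%:Z)].

(** The test [a <= i] guards the absolute value, which would otherwise fold positions before a into
    the block. *)
Definition overwrite (a : int) (m : nat) (W : {ffun 'I_m -> A}) y : config A :=
  fun i => if a <= i then
    (if insub (absz (i - a)) is Some j then W j else y i) else y i.

Lemma overwrite_in a m (W : {ffun 'I_m -> A}) y (j : 'I_m) :
  overwrite a W y (a + j%:Z) = W j.
Proof.
rewrite /overwrite; have -> : a <= a + j%:Z by lia.
have -> : absz (a + j%:Z - a)%R = j by lia.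
by rewrite insubT // => jm; congr (W _); apply: val_inj.
Qed.

Lemma overwrite_out a m (W : {ffun 'I_m -> A}) y i :
  ~~ (a <= i < a + m%:Z) -> overwrite a W y i = y i.
Proof.
move=> im; rewrite /overwrite; case: ifP => // ai.
by rewrite insubF //; apply/negbTE; lia.
Qed.

Lemma word_overwrite a m (W : {ffun 'I_m -> A}) y : word a m (overwrite a W y) = W.
Proof. by apply/ffunP => j; rewrite ffunE overwrite_in. Qed.

Lemma overwrite_inside a m (i : int) : a <= i < a + m%:Z ->
  exists j : 'I_m, i = a + j%:Z.
Proof.
move=> /andP[ai im]; have lt : (absz (i - a)%R < m)%N by lia.
by exists (Ordinal lt) => /=; lia.
Qed.

Lemma overwrite_eq a m y z :
  (forall i, ~~ (a <= i < a + m%:Z) -> y i = z i) ->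
  overwrite a (word a m y) z = y.
Proof.
move=> yz; apply/funext => i.
have [/overwrite_inside[j ->]|iam] := boolP (a <= i < a + m%:Z).
  by rewrite overwrite_in ffunE.
by rewrite overwrite_out // yz.
Qed.

Lemma eq_word_subword a b m x y :
  word a m x = word b m y <-> subword x a m = subword y b m.
Proof.
split=> [/ffunP e|e].
  by apply: eq_subword => k km; have := e (Ordinal km); rewrite !ffunE.
case: m e => [|m] e; first by apply/ffunP => -[].
apply/ffunP => i; rewrite !ffunE.
have := congr1 (fun s => seq.nth (x 0) s i) e.
by rewrite !nth_mkseq.
Qed.

Lemma word_shift a m b x : word a m (shift_map b x) = word (a + b) m x.
Proof.
by apply/ffunP => i; rewrite !ffunE /shift_map; congr (x _); lia.
Qed.

End Words.

(** For every margin N, [insert_word] gives a block W that is admissible together with N coordinates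
    of x on either side. There are finitely many W, so one of them serves every N, and closedness of
    Y puts the whole point in Y. *)
Lemma insert_config (A : pointedFinType) (Y : set (config A)) :
  sofic Y -> irreducible Y -> Y !=set0 ->
  exists L : nat, forall n x y, Y x -> Y y ->
  exists W : {ffun 'I_(n + L.*2) -> A}, Y (overwrite (- L%:Z) W x) /\
    exists2 r, (r <= L.*2)%N &
      word (r%:Z - L%:Z) n (overwrite (- L%:Z) W x) = word 0 n y.
Proof.
move=> sY irrY Y0; have [S [P HP]] := sofic_presentation sY.
have [L LP] := insert_word HP irrY Y0; exists L => n x y Yx Yy.
have [[clY shY] _] := sY.
pose m := (n + L.*2)%N; pose z (W : {ffun 'I_m -> A}) := overwrite (- L%:Z) W x.
pose long N W := subword (z W) (- L%:Z - N%:Z) (N + (m + N)).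
have long_mono M N W : (M <= N)%N -> language Y (long N W) -> language Y (long M W).
  move=> MN; rewrite /long.
  have -> : (N + (m + N) = (N - M) + ((M + (m + M)) + (N - M)))%N by lia.
  rewrite subwordD => /(language_cat HP)[_]; rewrite subwordD.
  have -> : - L%:Z - N%:Z + (N - M)%N%:Z = - L%:Z - M%:Z by lia.
  by case/(language_cat HP).
have ex N : exists W, (exists2 r, (r <= L.*2)%N &
      word (r%:Z - L%:Z) n (z W) = word 0 n y) /\ language Y (long N W).
  have [|||w1 [w2 [Lw w12]]] := LP (subword x (- L%:Z - N%:Z) N)
    (subword x (- L%:Z) m) (subword x (- L%:Z + m%:Z) N) (subword y 0 n).
  - have := subwordD x (- L%:Z - N%:Z) N (m + N); rewrite subrK (subwordD x (- L%:Z) m N) => <-.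
    by exists x => //; exact: appears_subword.
  - by exists y => //; exact: appears_subword.
  - by rewrite !size_subword.
  set w := w1 ++ subword y 0 n ++ w2.
  have sw : size w = m by rewrite /w !size_cat size_subword /m -w12; lia.
  pose W := [ffun i : 'I_m => seq.nth point w i].
  have zW : subword (z W) (- L%:Z) m = w.
    apply: (@eq_from_nth _ point); rewrite size_subword ?sw // => i im.
    by rewrite nth_mkseq //; apply: etrans (overwrite_in _ W x (Ordinal im)) _; rewrite ffunE.
  exists W; split.
    exists (size w1); first by lia.
    apply/eq_word_subword; have := congr1 (take n \o drop (size w1)) zW => /=.
    rewrite /w drop_size_cat // take_size_cat ?size_subword // => <-.
    have -> : m = (size w1 + (n + size w2))%N by rewrite /m; lia.
    rewrite subwordD drop_size_cat ?size_subword // subwordD.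
    by rewrite take_size_cat ?size_subword // addrC.
  rewrite /long subwordD subwordD subrK zW.
  have -> : subword (z W) (- L%:Z - N%:Z) N = subword x (- L%:Z - N%:Z) N.
    by apply: eq_subword => k kN; rewrite /z overwrite_out //; lia.
  have -> : subword (z W) (- L%:Z + m%:Z) N = subword x (- L%:Z + m%:Z) N.
    by apply: eq_subword => k kN; rewrite /z overwrite_out //; lia.
  by rewrite /w -!catA in Lw *.
(* If each W failed at some margin [N W], the block found for the largest of these margins would, by
   [long_mono], not fail at its own. *)
have [W WP] : exists W, forall N, (exists2 r, (r <= L.*2)%N &
      word (r%:Z - L%:Z) n (z W) = word 0 n y) /\ language Y (long N W).
  apply: contrapT => nW.
  have /choice[N NP] W : exists N, ~ ((exists2 r, (r <= L.*2)%N &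
      word (r%:Z - L%:Z) n (z W) = word 0 n y) /\ language Y (long N W)).
    by apply: contrapT => nN; apply: nW; exists W => N; apply: contrapT => nG;
      apply: nN; exists N.
  have [W [rP LW]] := ex (\max_W N W).
  by apply: (NP W); split => //; apply: long_mono LW; exact: leq_bigmax.
exists W; split; last by have [] := WP 0%N.
apply: (closed_agree clY) => N.
(* The margin is N + 1 because [long] omits its right end point, while [agree N] includes the
   coordinate N. *)
have [_ [u Yu /appearsP[i]]] := WP N.+1; rewrite size_subword => uE.
exists (shift_map (i + L%:Z + N.+1%:Z) u); first exact: shY.
move=> l lN.
have lt : (absz (l + L%:Z + N.+1%:Z)%R < N.+1 + (m + N.+1))%N by rewrite /m; lia.
have /eq_word_subword/ffunP/(_ (Ordinal lt)) := uE; rewrite !ffunE /= /z /shift_map.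
have -> : - L%:Z - N.+1%:Z + (absz (l + L%:Z + N.+1%:Z)%R)%:Z = l by lia.
by move=> ->; congr (u _); lia.
Qed.

(** * Finite-valued random variables *)

Section FiniteValued.
Context d (T : measurableType d) (R : realType) (mu : probability T R).
Implicit Types (D E : set T).

Definition pr E : R := fine (mu E).

Lemma pr_ge0 E : 0 <= pr E.
Proof. exact/fine_ge0/measure_ge0. Qed.

Lemma prE E : measurable E -> mu E = (pr E)%:E.
Proof. by move=> mE; rewrite fineK // fin_num_measure. Qed.

Lemma pr_le D E : measurable D -> measurable E -> D `<=` E -> pr D <= pr E.
Proof.
by move=> mD mE DE; rewrite -lee_fin -!prE //; apply: le_measure; rewrite ?inE.
Qed.

Lemma pr_le1 E : measurable E -> pr E <= 1.
Proof. by move=> mE; rewrite -lee_fin -prE // probability_le1. Qed.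

Lemma pr_setU_le D E : measurable D -> measurable E ->
  pr (D `|` E) <= pr D + pr E.
Proof.
move=> mD mE; rewrite -lee_fin EFinD -!prE //; first exact: measureU2.
exact: measurableU.
Qed.

Lemma pr_setU D E : measurable D -> measurable E -> D `&` E = set0 ->
  pr (D `|` E) = pr D + pr E.
Proof.
move=> mD mE DE; apply: EFin_inj; rewrite EFinD -!prE //.
  exact: measureU.
exact: measurableU.
Qed.

Lemma pr_bigcup_le (I : finType) D (E : I -> set T) :
  measurable D -> (forall i, measurable (E i)) -> D `<=` \bigcup_i E i ->
  pr D <= \sum_i pr (E i).
Proof.
move=> mD mE DE.
have key (s : seq I) : measurable [set x | exists2 i, i \in s & E i x] /\
    pr [set x | exists2 i, i \in s & E i x] <= \sum_(i <- s) pr (E i).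
  elim: s => [|i s [ms IH]].
    rewrite big_nil; set Z := [set x | _].
    have -> : Z = set0 by apply/seteqP; split => // x [].
    by split; rewrite // /pr measure0.
  have -> : [set x | exists2 j, j \in i :: s & E j x] =
      E i `|` [set x | exists2 j, j \in s & E j x].
    apply/seteqP; split=> [x [j]|x [Eix|[j js Ejx]]].
    - by rewrite inE => /orP[/eqP ->|js] Ejx; [left|right; exists j].
    - by exists i => //; rewrite inE eqxx.
    - by exists j => //; rewrite inE js orbT.
  split; first exact: measurableU.
  by rewrite big_cons (le_trans (pr_setU_le _ _)) // lerD2l.
have [ms] := key (index_enum I); apply: le_trans; apply: pr_le => // x /DE[i _ Eix].
by exists i => //; rewrite mem_index_enum.
Qed.

Definition finite_valued (F : finType) (phi : T -> F) : Prop :=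
  forall t, measurable (phi @^-1` [set t]).

Definition law (F : finType) (phi : T -> F) (t : F) : R :=
  pr (phi @^-1` [set t]).

Lemma law_ge0 (F : finType) (phi : T -> F) t : 0 <= law phi t.
Proof. exact: pr_ge0. Qed.

Lemma finite_valued_preimage (F : finType) (phi : T -> F) (V : set F) :
  finite_valued phi -> measurable (phi @^-1` V).
Proof.
move=> mphi; have -> : phi @^-1` V = \bigcup_(t in V) phi @^-1` [set t].
  apply/seteqP; split=> [x Vx|x [t Vt /= xt]]; first by exists (phi x).
  by rewrite /preimage /= xt.
by apply: fin_bigcup_measurable => //; exact: finite_finset.
Qed.

Lemma finite_valued_comp (F G : finType) (phi : T -> F) (g : F -> G) :
  finite_valued phi -> finite_valued (g \o phi).
Proof.
by move=> mphi t; exact: (finite_valued_preimage (g @^-1` [set t]) mphi).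
Qed.

Lemma pr_sum (F : finType) (phi : T -> F) E : finite_valued phi ->
  measurable E -> pr E = \sum_t pr (E `&` phi @^-1` [set t]).
Proof.
move=> mphi mE.
have key (s : seq F) : uniq s ->
    pr (E `&` phi @^-1` [set` s]) = \sum_(t <- s) pr (E `&` phi @^-1` [set t]).
  elim: s => [_|t s IH /= /andP[ts us]].
    rewrite big_nil; set Z := _ `&` _.
    have -> : Z = set0 by apply/seteqP; split => // x [].
    by rewrite /pr measure0.
  rewrite big_cons -IH // -pr_setU.
  - congr pr; rewrite -setIUr; congr (_ `&` _); apply/seteqP; split=> x /=.
      by rewrite inE => /orP[/eqP ->|]; [left|right].
    by rewrite inE => -[-> | ->]; rewrite ?eqxx ?orbT.
  - exact: measurableI.
  - by apply: measurableI => //; exact: finite_valued_preimage.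
  - apply/seteqP; by split=> // x [[_ /= xt] [_ /=]]; rewrite xt (negbTE ts).
rewrite -(key _ (index_enum_uniq F)); congr pr.
by apply/seteqP; split=> [x Ex|x []//]; split => //=; rewrite mem_index_enum.
Qed.

Lemma law_comp (F G : finType) (phi : T -> F) (g : F -> G) s :
  finite_valued phi -> law (g \o phi) s = \sum_(t | g t == s) law phi t.
Proof.
move=> mphi; rewrite /law (pr_sum mphi); last exact: finite_valued_comp.
rewrite (bigID (fun t => g t == s)) /= [X in _ + X]big1 ?addr0.
  apply: eq_bigr => t /eqP gts; congr pr; apply/seteqP; split=> [x [] //|x /= xt].
  by split => //=; rewrite xt.
move=> t /eqP gts; rewrite (_ : _ `&` _ = set0) /pr ?measure0 //.
by apply/seteqP; split => // x [/= gx xt]; apply: gts; rewrite -xt.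
Qed.

Lemma expectation_comp (F G : finType) (phi : T -> F) (g : F -> G) (h : G -> R) :
  finite_valued phi ->
  \sum_s law (g \o phi) s * h s = \sum_t law phi t * h (g t).
Proof.
move=> mphi; rewrite [RHS](partition_big g predT) //=.
apply: eq_bigr => s _; rewrite law_comp // mulr_suml.
by apply: eq_bigr => t /eqP ->.
Qed.

Lemma sum_law (F : finType) (phi : T -> F) : finite_valued phi ->
  \sum_t law phi t = 1.
Proof.
move=> mphi; have := pr_sum mphi measurableT.
under eq_bigr do rewrite setTI.
by move=> <-; rewrite /pr probability_setT.
Qed.

Lemma pr_setI_full D E : measurable D -> measurable E -> mu D = 1%E ->
  pr (D `&` E) = pr E.
Proof.
move=> mD mE D1.
have mDC : measurable (~` D) by exact: measurableC.
have DC0 : pr (~` D) = 0 by rewrite /pr probability_setC // D1 subee.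
apply/le_anti/andP; split; first by apply: pr_le => //; exact: measurableI.
rewrite -[X in _ <= X]addr0 -DC0; apply: le_trans (pr_setU_le _ _) => //.
  apply: pr_le => //; first by apply: measurableU => //; exact: measurableI.
  by move=> x Ex; have [Dx|Dx] := pselect (D x); [left|right].
exact: measurableI.
Qed.

(** The function is a finite sum of multiples of indicators. Integrability is proved along with the
    value, as additivity of the integral asks for it at each step of the induction. *)
Lemma Rintegral_finite_valued (F : finType) (phi : T -> F) (h : F -> R) D :
  finite_valued phi -> measurable D -> mu D = 1%E ->
  mu.-integrable D (EFin \o (h \o phi)) /\
  \int[mu]_(x in D) h (phi x) = \sum_t law phi t * h t.
Proof.
move=> mphi mD D1.
pose g t x := h t * \1_(phi @^-1` [set t]) x : R.
have gint t : mu.-integrable D (EFin \o g t).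
  apply: (measurable_bounded_integrable mD); first exact: (le_lt_trans (probability_le1 mu mD) (ltry _)).
    by apply: measurable_funM => //; exact: measurable_indic.
  exists `|h t|; split; first exact: num_real.
  move=> M hM x _ /=; apply: le_trans (ltW hM).
  rewrite /g normrM ler_piMr // indicE; case: (_ \in _); by rewrite ?normr1 ?normr0.
have iE t : \int[mu]_(x in D) g t x = law phi t * h t.
  rewrite RintegralZl //.
    rewrite mulrC; congr (_ * _); rewrite /Rintegral integral_indic //.
    by rewrite setIC; exact: pr_setI_full.
  apply: (measurable_bounded_integrable mD); first exact: (le_lt_trans (probability_le1 mu mD) (ltry _)).
    exact: measurable_indic.
  exists 1; split; first exact: num_real.
  move=> M hM x _ /=; apply: le_trans (ltW hM).
  by rewrite indicE; case: (_ \in _); rewrite ?normr1 ?normr0.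
have -> : h \o phi = fun x => \sum_t g t x.
  apply/funext => x /=; rewrite (bigD1 (phi x)) //= /g indicE mem_set // mulr1.
  rewrite big1 ?addr0 // => t /eqP tx; rewrite indicE memNset ?mulr0 //.
  by move=> /= /esym.
have -> : \int[mu]_(x in D) h (phi x) = \int[mu]_(x in D) \sum_t g t x.
  apply: eq_Rintegral => x _; rewrite (bigD1 (phi x)) //= /g indicE mem_set // mulr1.
  rewrite big1 ?addr0 // => t /eqP tx; rewrite indicE memNset ?mulr0 //.
  by move=> /= /esym.
elim: (index_enum F) => [|t s [IHi IHs]].
  split.
    apply: (eq_integrable mD (cst 0%E)); last exact: integrable0.
    by move=> x _ /=; rewrite big_nil.
  by under eq_Rintegral do rewrite big_nil; rewrite big_nil Rintegral_cst // mul0r.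
split.
  pose k x : R := \sum_(t <- s) g t x.
  apply: (eq_integrable mD ((EFin \o g t) \+ (EFin \o k))%E).
    by move=> x _ /=; rewrite big_cons.
  exact: integrableD.
under eq_Rintegral do rewrite big_cons.
by rewrite RintegralD // IHs iE big_cons.
Qed.

End FiniteValued.

(** Apply ln s <= s - 1 to s = q t / p t wherever p t is nonzero. Only a total mass at most 1 is
    asked of q, so unnormalized weights are allowed. *)
Lemma gibbs_inequality (R : realType) (F : finType) (p q : F -> R) :
  (forall t, 0 <= p t) -> (forall t, 0 <= q t) ->
  (forall t, p t != 0 -> 0 < q t) ->
  \sum_t p t = 1 -> \sum_t q t <= 1 ->
  \sum_t - (p t * ln (p t)) <= \sum_t p t * - ln (q t).
Proof.
move=> p0 q0 pq p1 q1; rewrite -subr_le0 -sumrB.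
apply: (@le_trans _ _ (\sum_t (q t - p t))); last by rewrite sumrB p1; lra.
apply: ler_sum => t _; have [->|pt] := eqVneq (p t) 0.
  by rewrite !mul0r oppr0 !addr0.
have pt0 : 0 < p t by rewrite lt_def pt p0.
have qt0 := pq t pt.
have -> : - (p t * ln (p t)) - p t * - ln (q t) = p t * ln (q t / p t).
  by rewrite ln_div ?posrE //; ring.
have -> : q t - p t = p t * (q t / p t - 1) by field.
rewrite ler_pM2l //.
have := @le_ln1Dx R (q t / p t - 1); rewrite (addrC 1) subrK; apply.
by rewrite ltrBrDr addNr divr_gt0.
Qed.

(** * Potentials of summable variation *)

Section ConfigMeasurable.
Context {A : pointedFinType}.

Lemma open_config_measurable (U : set (config A)) : open U -> measurable U.
Proof. by move=> oU; apply: sub_sigma_algebra. Qed.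

Lemma closed_config_measurable (U : set (config A)) : closed U -> measurable U.
Proof.
move=> cU; rewrite -(setCK U); apply: measurableC.
by apply: open_config_measurable; exact: closed_openC.
Qed.

Lemma agree_word N a m (x y : config A) :
  agree N x y -> (absz a <= N)%N -> (absz (a + m%:Z)%R <= N)%N ->
  word a m x = word a m y.
Proof.
move=> xy aN amN; apply/ffunP => i; rewrite !ffunE; apply: xy.
by have := ltn_ord i; lia.
Qed.

Lemma word_open a m (V : set {ffun 'I_m -> A}) : open (word a m @^-1` V).
Proof.
apply/open_agreeP => x Vx; exists (absz a + m)%N => y xy /=.
by rewrite /preimage /= -(agree_word xy) //; lia.
Qed.

Lemma finite_valued_word a m : finite_valued (word a m : config A -> _).
Proof. by move=> t; apply: open_config_measurable; exact: word_open. Qed.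

(** The condition is uniform continuity expressed by windows, so preimages of open sets are open. *)
Lemma local_measurable (phi : config A -> config A) :
  (forall N, exists M, forall x y, agree M x y -> agree N (phi x) (phi y)) ->
  measurable_fun setT phi.
Proof.
move=> loc; apply: (@measurability _ _ _ _ setT phi (@open (config A))) => // _ [U oU <-].
rewrite setTI; apply: open_config_measurable; apply/open_agreeP => x Ux.
have [N NU] := (open_agreeP U).1 oU _ Ux; have [M MN] := loc N.
by exists M => y /MN/NU.
Qed.

Lemma shift_map_measurable a : measurable_fun setT (@shift_map A a).
Proof.
apply: local_measurable => N; exists (N + absz a)%N => x y xy n nN.
by rewrite /shift_map xy //; lia.
Qed.

Lemma overwrite_measurable a m W : measurable_fun setT (@overwrite A a m W).
Proof.
apply: local_measurable => N; exists N => x y xy n nN.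
have [/overwrite_inside[j ->]|nam] := boolP (a <= n < a + m%:Z).
  by rewrite !overwrite_in.
by rewrite !overwrite_out // xy.
Qed.

Lemma preimage_measurable (phi : config A -> config A) U :
  measurable_fun setT phi -> measurable U -> measurable (phi @^-1` U).
Proof. by move=> mphi mU; rewrite -[_ @^-1` _]setTI; exact: mphi. Qed.

Lemma shift_mapD a b (x : config A) :
  shift_map a (shift_map b x) = shift_map (a + b) x.
Proof. by apply/funext => i; rewrite /shift_map; congr (x _); lia. Qed.

Lemma shift_map0 (x : config A) : shift_map 0 x = x.
Proof. by apply/funext => i; rewrite /shift_map addr0. Qed.

Lemma iter_shift i (x : config A) : iter i (shift_map 1) x = shift_map i%:Z x.
Proof.
elim: i => [|i IH] /=; first by rewrite shift_map0.
by rewrite IH shift_mapD; congr (shift_map _ x); lia.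
Qed.

Context (R : realType) (mu : probability (config A) R).

Lemma shift_invariantE a U : shift_invariant mu -> measurable U ->
  mu (shift_map a @^-1` U) = mu U.
Proof.
move=> inv mU; have nat_case n V : measurable V -> mu (shift_map n%:Z @^-1` V) = mu V.
  move=> mV; elim: n => [|n IH].
    by congr (mu _); apply/seteqP; split=> x /=; rewrite shift_map0.
  rewrite -IH -[RHS]inv; last first.
    by apply: preimage_measurable => //; exact: shift_map_measurable.
  congr (mu _); apply/seteqP; split=> x /=; rewrite shift_mapD;
    by have -> : n.+1%:Z = n%:Z + 1 by lia.
case: a => n; first exact: nat_case.
(* For a negative exponent, pull back further by the opposite positive power, which preserves the
   measure and cancels it. *)
rewrite -(nat_case n.+1); last first.
  by apply: preimage_measurable => //; exact: shift_map_measurable.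
congr (mu _); apply/seteqP; split=> x /=; rewrite shift_mapD NegzE;
  by rewrite addNr shift_map0.
Qed.

Lemma law_shift a (F : finType) (phi : config A -> F) : shift_invariant mu ->
  finite_valued phi -> law mu (phi \o shift_map a) =1 law mu phi.
Proof.
move=> inv mphi t; rewrite /law /pr; congr fine.
by rewrite -[RHS](shift_invariantE a inv) //; exact: mphi.
Qed.

Lemma law_word a b m : shift_invariant mu ->
  law mu (word a m) =1 law mu (word b m).
Proof.
move=> inv t; rewrite -[RHS](law_shift (a - b) inv (@finite_valued_word b m)).
congr pr; apply/seteqP; split=> x /=; rewrite word_shift;
  by have -> : b + (a - b) = a by lia.
Qed.

End ConfigMeasurable.

(** * Variations, Birkhoff sums and the cocycle *)

Section Potential.
Context (R : realType) (A : pointedFinType) (Y : set (config A)).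
Context (f : config A -> R) (HY : shift_space Y) (Y0 : Y !=set0).
Context (f_SV : summable_variation Y f).

Definition modulus (k : nat) : R := fine (Defs.variation Y f k%:Z).

Let shY a x : Y x -> Y (shift_map a x). Proof. by move: HY => [_ +]; apply. Qed.

Lemma variation_ge0 k : (0 <= Defs.variation Y f k)%E.
Proof.
have [y Yy] := Y0; case: k => k /=.
  apply: ereal_sup_ubound; exists y, y; split => //.
  by rewrite subrr normr0.
apply: (@le_trans _ _ (`|f y|)%:E); first by rewrite lee_fin.
by apply: ereal_sup_ubound; exists y.
Qed.

(** The first term is v_{-1}, the sup norm; the sum of the v_k over k >= 0 is therefore bounded by
    this number as well. *)
Definition total_variation : R :=
  fine (\sum_(0 <= k <oo) Defs.variation Y f (k%:Z - 1))%E.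

Lemma variation_sum_le n :
  (\sum_(0 <= k < n) Defs.variation Y f (k%:Z - 1) <= total_variation%:E)%E.
Proof.
have [_ fin] := f_SV; rewrite fineK; last first.
  rewrite ge0_fin_numE //; apply: nneseries_ge0 => k _ _; exact: variation_ge0.
by apply: nneseries_lim_ge => k _ _; exact: variation_ge0.
Qed.

Lemma variation_fin k : (Defs.variation Y f (k%:Z - 1) \is a fin_num)%E.
Proof.
rewrite ge0_fin_numE ?variation_ge0 //.
apply: le_lt_trans (le_lt_trans (variation_sum_le k.+1) (ltry _)).
rewrite big_nat_recr //= leeDr //; apply: sume_ge0 => i _; exact: variation_ge0.
Qed.

Lemma modulusE k : Defs.variation Y f k%:Z = (modulus k)%:E.
Proof.
rewrite fineK //; have := variation_fin k.+1.
by have -> : k.+1%:Z - 1 = k%:Z by lia.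
Qed.

Lemma modulus_ge0 k : 0 <= modulus k.
Proof. exact/fine_ge0/variation_ge0. Qed.

Lemma dist_le_modulus k x y : Y x -> Y y -> agree k x y ->
  `|f x - f y| <= modulus k.
Proof.
move=> Yx Yy xy; rewrite -lee_fin -modulusE.
by apply: ereal_sup_ubound; exists x, y.
Qed.

Definition sup_norm : R := fine (Defs.variation Y f (-1)).

Lemma norm_le_sup_norm x : Y x -> `|f x| <= sup_norm.
Proof.
move=> Yx; rewrite -lee_fin fineK; last exact: (variation_fin 0).
by apply: ereal_sup_ubound; exists x.
Qed.

Lemma sup_norm_ge0 : 0 <= sup_norm.
Proof. by have [y Yy] := Y0; exact: le_trans (norm_le_sup_norm Yy). Qed.

Lemma sum_modulus_le n : \sum_(0 <= k < n) modulus k <= total_variation.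
Proof.
have := variation_sum_le n.+1; rewrite big_nat_recl // -/total_variation => h.
rewrite -lee_fin; apply: le_trans h; rewrite -sumEFin.
rewrite -[X in (X <= _)%E]add0e leeD ?variation_ge0 //.
apply: lee_sum => k _; rewrite -modulusE.
by have -> : k.+1%:Z - 1 = k%:Z by lia.
Qed.

Lemma modulus_series_cvg : cvgn (series modulus).
Proof.
apply: nondecreasing_is_cvgn.
  by apply/nondecreasing_series => n _ _; exact: modulus_ge0.
by exists total_variation => _ [n _ <-]; exact: sum_modulus_le.
Qed.

Definition birkhoff (n : nat) (x : config A) : R :=
  \sum_(i < n) f (shift_map i%:Z x).

Lemma birkhoffD m n x :
  birkhoff (m + n) x = birkhoff m x + birkhoff n (shift_map m%:Z x).
Proof.
rewrite /birkhoff big_split_ord /=; congr (_ + _); apply: eq_bigr => i _.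
by rewrite shift_mapD; congr (f (shift_map _ x)); lia.
Qed.

Lemma birkhoff_norm n x : Y x -> `|birkhoff n x| <= n%:R * sup_norm.
Proof.
move=> Yx; apply: le_trans (ler_norm_sum _ _ _) _.
apply: (@le_trans _ _ (\sum_(i < n) sup_norm)).
  by apply: ler_sum => i _; apply: norm_le_sup_norm; exact: shY.
by rewrite sumr_const card_ord mulr_natl.
Qed.

(* At time i the two orbits agree up to distance min(i, n - 1 - i). *)
Lemma birkhoff_dist n x y : Y x -> Y y -> word 0 n x = word 0 n y ->
  `|birkhoff n x - birkhoff n y| <= total_variation *+ 2.
Proof.
move=> Yx Yy /ffunP xy.
have xyE (i : int) : 0 <= i < n%:Z -> x i = y i.
  move=> /andP[i0 ilt]; have lt : (absz i < n)%N by lia.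
  have := xy (Ordinal lt); rewrite !ffunE /= add0r.
  by have -> : (absz i)%:Z = i by lia.
rewrite /birkhoff -sumrB; apply: le_trans (ler_norm_sum _ _ _) _.
apply: (@le_trans _ _ (\sum_(i < n) (modulus i + modulus (n.-1 - i)%N))).
  apply: ler_sum => i _.
  have [il|il] := leqP i (n.-1 - i)%N.
    apply: (@le_trans _ _ (modulus i)); last by rewrite lerDl modulus_ge0.
    apply: dist_le_modulus; [exact: shY|exact: shY|] => j jl; apply: xyE.
    by have := ltn_ord i; lia.
  apply: (@le_trans _ _ (modulus (n.-1 - i)%N)); last by rewrite lerDr modulus_ge0.
  apply: dist_le_modulus; [exact: shY|exact: shY|] => j jl; apply: xyE.
  by have := ltn_ord i; lia.
rewrite big_split /= mulr2n; apply: lerD.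
  by rewrite -(big_mkord predT modulus); exact: sum_modulus_le.
rewrite (reindex_inj rev_ord_inj) /=; apply: le_trans (sum_modulus_le n).
rewrite big_mkord le_eqVlt; apply/orP; left; apply/eqP.
by apply: eq_bigr => i _; congr modulus; have := ltn_ord i; lia.
Qed.

(** The window of radius k around j misses the block [a, a + m[, outside which x and y agree. *)
Lemma potential_tail_le (x y : config A) (a : int) (m k : nat) (j : int) :
  Y x -> Y y -> (forall i, ~~ (a <= i < a + m%:Z) -> x i = y i) ->
  (j <= a - 1 - k%:Z) || (a + m%:Z + k%:Z <= j) ->
  `|f (shift_map j y) - f (shift_map j x)| <= modulus k.
Proof.
move=> Yx Yy xy jk; apply: dist_le_modulus; [exact: shY|exact: shY|] => i ik.
by rewrite /shift_map xy //; lia.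
Qed.

(** The terms of the series with index in [a, a + m[ form the difference of Birkhoff sums. On either
    side of the block the successive terms are bounded by v_0, v_1, and so on, which costs one total
    variation per side. *)
Lemma potential_cocycle_ge (x y : config A) (a : int) (m : nat) (c : R) :
  Y x -> Y y -> (forall i, ~~ (a <= i < a + m%:Z) -> x i = y i) ->
  c <= birkhoff m (shift_map a y) - birkhoff m (shift_map a x) ->
  c - total_variation *+ 2 <= potential_cocycle f x y.
Proof.
move=> Yx Yy xy cm.
pose d j := f (shift_map j y) - f (shift_map j x).
pose isum (b : int) n := \sum_(0 <= i < n) d (b + i%:Z).
have isumD b p q : isum b (p + q)%N = isum b p + isum (b + p%:Z) q.
  rewrite /isum (big_cat_nat (n := p)) //= ?leq_addr //; congr (_ + _).
  rewrite -{1}[p]add0n big_addn addKn; apply: eq_bigr => i _.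
  by congr d; lia.
have dle k j : (j <= a - 1 - k%:Z) || (a + m%:Z + k%:Z <= j) -> `|d j| <= modulus k.
  by move=> ?; exact: (@potential_tail_le x y a m).
have isum1 b : isum b 1%N = d b by rewrite /isum big_nat1 addr0.
pose u N := isum (- N%:Z) N.*2.+1.
have uE : u = fun N => \sum_(0 <= i < N.*2.+1)
    (f (shift_map (i%:Z - N%:Z) y) - f (shift_map (i%:Z - N%:Z) x)).
  by apply/funext => N; apply: eq_bigr => i _; rewrite /d (addrC (- N%:Z)).
rewrite /potential_cocycle -uE.
apply: limr_ge.
  pose K := (absz a + m)%N.
  (* Past the radius K, which covers the block, enlarging the symmetric range adds a pair of terms
     [e k], bounded by 2 v_k. Convergence has to be shown, since [limn] of a divergent sequence is a
     default value. *)
  pose e k := d ((K + k)%N.+1%:Z) + d (- (K + k)%N.+1%:Z).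
  have uK N : u (N + K)%N = u K + \sum_(0 <= k < N) e k.
    elim: N => [|N IH]; first by rewrite big_geq // addr0.
    rewrite big_nat_recr //= addrA -IH /u addSn.
    have -> : (N + K).+1.*2.+1 = (1 + ((N + K).*2.+1 + 1))%N by lia.
    rewrite !isumD !isum1 /e [LHS]addrCA; congr (_ + _).
      by congr isum; lia.
    by rewrite addrC; congr (d _ + d _); lia.
  have : cvgn (series e).
    apply: normed_cvg; apply: (@series_le_cvg _ _ (modulus \+ modulus)) => //.
    - by move=> k; exact: normr_ge0.
    - by move=> k; rewrite /= addr_ge0 ?modulus_ge0.
    - move=> k /=; apply: le_trans (ler_normD _ _) _.
      by rewrite lerD // dle //; rewrite /K; lia.
    - have -> : series (modulus \+ modulus) = series modulus \+ series modulus.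
        by apply/funext => n; rewrite /series /= big_split.
      by apply: is_cvgD; exact: modulus_series_cvg.
  move=> /cvg_ex[l el]; apply/cvg_ex; exists (u K + l).
  rewrite -(@cvg_shiftn K); under eq_fun do rewrite uK.
  by apply: cvgD => //; exact: cvg_cst.
(* From here on the block lies in [-N, N], which splits into p terms before it, the m terms of the
   block and q terms after it. *)
exists (absz a + m)%N => // N /= aN.
have [p pE] : exists p, p%:Z = a + N%:Z by exists (absz (a + N%:Z)%R); lia.
have [q qE] : exists q, q%:Z = N%:Z + 1 - a - m%:Z.
  by exists (absz (N%:Z + 1 - a - m%:Z)%R); lia.
rewrite /u (_ : N.*2.+1 = p + (m + q))%N; last by lia.
rewrite !isumD.
have -> : - N%:Z + p%:Z = a by lia.
have mid : isum a m = birkhoff m (shift_map a y) - birkhoff m (shift_map a x).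
  rewrite /isum big_mkord /birkhoff -sumrB; apply: eq_bigr => i _.
  by rewrite !shift_mapD /d (addrC a).
have left_le : `|isum (- N%:Z) p| <= total_variation.
  apply: le_trans (ler_norm_sum _ _ _) _; apply: le_trans (sum_modulus_le p).
  rewrite [leRHS]big_nat_rev /=; apply: ler_sum_nat => i ip.
  by apply: dle; lia.
have right_le : `|isum (a + m%:Z) q| <= total_variation.
  apply: le_trans (ler_norm_sum _ _ _) _; apply: le_trans (sum_modulus_le q).
  by apply: ler_sum_nat => i iq; apply: dle; lia.
move: left_le right_le; rewrite !ler_norml mid mulr2n => /andP[? _] /andP[? _].
lra.
Qed.

End Potential.

(** * Partition functions *)

Section Averages.
Context {R : realType}.
Implicit Types (a h : nat -> R).

Definition avg a : nat -> R := fun n => n%:R^-1 * a n.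

Lemma invn_mul_near (K e : R) : 0 < e ->
  exists N, forall n, (N <= n)%N -> (0 < n)%N /\ n%:R^-1 * K <= e.
Proof.
move=> e0; have Ke : 0 <= `|K| / e by rewrite divr_ge0 // ltW.
exists (Num.bound (`|K| / e)).+1 => n nN; have n0 : (0 < n)%N by lia.
split => //; rewrite mulrC ler_pdivrMr ?ltr0n // mulrC -ler_pdivrMr //.
apply: (@le_trans _ _ (`|K| / e)); first by rewrite ler_pM2r ?invr_gt0 // ler_norm.
by apply: le_trans (ltW (archi_boundP Ke)) _; rewrite ler_nat; lia.
Qed.

(** Fekete's lemma for [a + c], which is subadditive: the limit is the infimum of (a n + c) / n over
    n > 0. An m that nearly attains the infimum controls all large n by division with remainder. *)
Lemma fekete a (B c : R) : (forall m n, a (m + n)%N <= a m + a n + c) ->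
  (forall n, - (n%:R * B) <= a n) -> cvgn (avg a).
Proof.
move=> sub lb; pose E := [set avg (fun n => a n + c) n | n in [set n | (0 < n)%N]].
have B0 : - (1 * `|B| + `|c|) \in lbound E.
  rewrite inE => _ [n /= n0 <-]; rewrite /avg ler_pdivlMl ?ltr0n //.
  have n1 : 1 <= n%:R :> R by rewrite ler1n.
  have := lb n; have := ler_norm B; have := ler_norm (- c); rewrite normrN.
  have := normr_ge0 B; have := normr_ge0 c.
  by move=> *; nra.
have hE : has_inf E.
  split; first by exists (avg (fun n => a n + c) 1), 1%N.
  by exists (- (1 * `|B| + `|c|)); exact/set_mem.
apply/cvg_ex; exists (inf E); apply/cvgrPdist_le => e e0.
have e2 : 0 < e / 2 by lra.
have [_ [m /= m0 <-] mE] := inf_adherent e2 hE.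
set l := inf E in mE *.
pose K := \sum_(r < m) `|a r + c|.
have step q r : (r < m)%N -> a (q * m + r)%N + c <= q%:R * (a m + c) + K.
  move=> rm; elim: q => [|q IH].
    rewrite mul0n add0n mul0r add0r /K (bigD1 (Ordinal rm)) //=.
    apply: le_trans (ler_norm _) _; rewrite lerDl.
    by apply: sumr_ge0 => i _; exact: normr_ge0.
  rewrite mulSn -addnA; have := sub m (q * m + r)%N.
  by move: IH; rewrite -[in q.+1%:R]addn1 natrD; lra.
(* C gathers what does not grow with n: the values of [a + c] at remainders r < m, the deficit of n
   from a multiple of m, and c itself. *)
pose C := K + m%:R * `|l + e / 2| + `|c|.
have [N NP] := invn_mul_near C e2.
have [N' N'P] := invn_mul_near `|c| e2.
exists (N + N')%N => // n /= nN.
have [n0 nC] := NP n ltac:(lia); have [_ nc] := N'P n ltac:(lia).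
have nR : 0 < n%:R :> R by rewrite ltr0n.
have la : l <= avg (fun n => a n + c) n.
  by apply: ge_inf; [case: hE|exists n].
move: la nc nC mE; rewrite /avg.
rewrite ler_pdivlMl // !ler_pdivrMl // ltr_pdivrMl ?ltr0n // => la nc nC mE.
have dm := divn_eq n m; have rm := ltn_pmod n m0.
have := step (n %/ m)%N (n %% m)%N rm; rewrite -dm => st.
have nE : n%:R = (n %/ m)%:R * m%:R + (n %% m)%:R :> R.
  by rewrite -natrM -natrD -dm.
have q0 : 0 <= (n %/ m)%:R :> R by [].
have r0 : 0 <= (n %% m)%:R :> R by [].
have rmR : (n %% m)%:R <= m%:R :> R by rewrite ler_nat ltnW.
have h1 := ler_norm (- c); have h2 := ler_norm c; rewrite normrN in h1.
have h3 := ler_norm (- (l + e / 2)); rewrite normrN in h3.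
have h4 := normr_ge0 (l + e / 2).
have st2 : (n %/ m)%:R * (a m + c) <= (n %/ m)%:R * (m%:R * (l + e / 2)).
  by rewrite ler_wpM2l // ltW.
have h5 : - ((n %% m)%:R * (l + e / 2)) <= m%:R * `|l + e / 2|.
  apply: (@le_trans _ _ ((n %% m)%:R * `|l + e / 2|)).
    by rewrite -mulrN ler_wpM2l.
  by rewrite ler_wpM2r.
set v := n%:R^-1 * a n; have av : a n = n%:R * v.
  by rewrite /v mulrA divff ?mul1r // gt_eqF.
rewrite av in la st.
rewrite ler_norml; apply/andP; split; rewrite -(ler_pM2l nR).
  have nE2 : n%:R * (l + e / 2) = (n %/ m)%:R * (m%:R * (l + e / 2)) +
      (n %% m)%:R * (l + e / 2) by rewrite nE; ring.
  by rewrite /C in nC; move: nE2 st st2 h5 nC h1; lra.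
lra.
Qed.

(* The library's limit of a divergent sequence is the default value 0. *)
Lemma lim_avg_le a h p c : (avg a @ \oo --> p) -> (forall n, 0 <= h n) ->
  (forall e, 0 < e -> exists K, forall n, h n <= a n + n%:R * (c + e) + K) ->
  limn (avg h) <= p + c.
Proof.
move=> ap h0 hle; apply/ler_addgt0Pr => e e0.
have e3 : 0 < e / 3 by lra.
have [K hK] := hle _ e3; have [N NP] := invn_mul_near K e3.
have near_le : \forall n \near \oo, avg h n <= p + c + e.
  have [N' _ N'P] := (cvgrPdist_le _ _).1 ap _ e3.
  exists (N + N')%N => // n /= nN; have [n0 nK] := NP n ltac:(lia).
  have pa := N'P n ltac:(rewrite /=; lia); rewrite /avg.
  have nR : 0 < n%:R :> R by rewrite ltr0n.
  have := hK n; rewrite -(ler_pM2l (_ : 0 < n%:R^-1)) ?invr_gt0 //.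
  rewrite !mulrDr !mulrA mulVf ?gt_eqF // !mul1r -/(avg a n) => hn.
  by move: pa; rewrite ler_norml => /andP[]; move: nK; lra.
(* In the divergent case the default limit 0 lies below the bound, because some nonnegative value of
   [avg h] does. *)
have [cv|dv] := pselect (cvgn (avg h)); first exact: limr_le.
rewrite dvgP //; have [M _ MP] := near_le.
by apply: le_trans (MP M (leqnn M)); rewrite mulr_ge0 ?invr_ge0.
Qed.

(** Unlike [lim_avg_le], this proves convergence, so that an entropy defined as a limit receives its
    true value. *)
Lemma avg_cvg_squeeze a h p c : (avg a @ \oo --> p) ->
  (forall e, 0 < e -> exists K, forall n, h n <= a n + n%:R * (c + e) + K) ->
  (exists K, forall n, a n + n%:R * c - K <= h n) ->
  avg h @ \oo --> p + c.
Proof.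
move=> ap hle [K' hK']; apply/cvgrPdist_le => e e0.
have e3 : 0 < e / 3 by lra.
have [K hK] := hle _ e3; have [N NP] := invn_mul_near K e3.
have [N' NP'] := invn_mul_near K' e3.
have [N'' _ N''P] := (cvgrPdist_le _ _).1 ap _ e3.
exists (N + N' + N'')%N => // n /= nN; have [n0 nK] := NP n ltac:(lia).
have [_ nK'] := NP' n ltac:(lia).
have pa := N''P n ltac:(rewrite /=; lia); rewrite /avg.
have nR : 0 < n%:R :> R by rewrite ltr0n.
have := hK n; rewrite -(ler_pM2l (_ : 0 < n%:R^-1)) ?invr_gt0 //.
rewrite !mulrDr !mulrA mulVf ?gt_eqF // !mul1r -/(avg a n) => hn.
have := hK' n; rewrite -(ler_pM2l (_ : 0 < n%:R^-1)) ?invr_gt0 //.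
rewrite mulrBr !mulrDr !mulrA mulVf ?gt_eqF // !mul1r -/(avg a n) => hn'.
by move: pa; rewrite !ler_norml => /andP[? ?]; apply/andP; split; lra.
Qed.

End Averages.

(** * Partition functions and the mean of the potential *)

Section Partition.
Context (R : realType) (A : pointedFinType) (Y : set (config A)).
Context (f : config A -> R) (HY : shift_space Y) (Y0 : Y !=set0).
Context (f_SV : summable_variation Y f).
Notation TV := (total_variation Y f).

Let shY a x : Y x -> Y (shift_map a x). Proof. by move: HY => [_ +]; apply. Qed.

(** When Y is shift-invariant, looking at the coordinate 0 alone loses no word of the language. *)
Definition legal n (u : {ffun 'I_n -> A}) : bool :=
  `[< exists x, Y x /\ word 0 n x = u >].

Definition rep n (u : {ffun 'I_n -> A}) : config A :=
  xget point [set x | Y x /\ word 0 n x = u].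

Lemma repP n (u : {ffun 'I_n -> A}) : legal u -> Y (rep u) /\ word 0 n (rep u) = u.
Proof. by move/asboolP => ex; exact: (xgetPex point ex). Qed.

Lemma legal_word n x : Y x -> legal (word 0 n x).
Proof. by move=> Yx; apply/asboolP; exists x. Qed.

Definition energy n (u : {ffun 'I_n -> A}) : R := birkhoff f n (rep u).

Definition partition_function n : R :=
  \sum_(u : {ffun 'I_n -> A} | legal u) expR (energy u).

Lemma energy_dist n x : Y x ->
  `|birkhoff f n x - energy (word 0 n x)| <= TV *+ 2.
Proof.
move=> Yx; have [Yr wr] := repP (legal_word n Yx).
exact: birkhoff_dist.
Qed.

Lemma partition_function_ge n :
  expR (- (n%:R * sup_norm Y f)) <= partition_function n.
Proof.
have [y Yy] := Y0; rewrite /partition_function (bigD1 (word 0 n y)) ?legal_word //=.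
apply: (@le_trans _ _ (expR (energy (word 0 n y)))).
  rewrite ler_expR /energy; have [Yr _] := repP (legal_word n Yy).
  by have := birkhoff_norm HY Y0 f_SV n Yr; rewrite ler_norml => /andP[].
by rewrite lerDl; apply: sumr_ge0 => u _; exact: expR_ge0.
Qed.

Lemma partition_function_gt0 n : 0 < partition_function n.
Proof. exact: lt_le_trans (expR_gt0 _) (partition_function_ge n). Qed.

(** Cutting a legal word into its first m and last n letters is injective into pairs of legal words.
    Each half has an energy within 2 TV of the corresponding part of the Birkhoff sum, whence the
    factor exp(4 TV). *)
Lemma partition_functionD m n :
  partition_function (m + n) <=
  expR (TV *+ 4) * (partition_function m * partition_function n).
Proof.
pose h (w : {ffun 'I_(m + n) -> A}) := (word 0 m (rep w), word m%:Z n (rep w)).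
have h_inj : {in [pred w | legal w] &, injective h}.
  move=> w w' lw lw' [/ffunP h1 /ffunP h2].
  rewrite -(repP lw).2 -(repP lw').2.
  apply/ffunP => i; rewrite !ffunE; case: (ltnP i m) => im.
    by have := h1 (Ordinal im); rewrite !ffunE.
  have lt : (i - m < n)%N by have := ltn_ord i; lia.
  have := h2 (Ordinal lt); rewrite !ffunE /=.
  by have -> : m%:Z + (i - m)%N%:Z = 0 + i%:Z by lia.
pose G (p : {ffun 'I_m -> A} * {ffun 'I_n -> A}) :=
  expR (energy p.1) * expR (energy p.2).
have hlegal w : legal w -> legal (h w).1 /\ legal (h w).2.
  move=> /repP[Yr _]; split; first exact: legal_word.
  by rewrite /= -[m%:Z]add0r -word_shift; apply: legal_word; exact: shY.
apply: (@le_trans _ _ (\sum_(w in [pred w | legal w]) expR (TV *+ 4) * G (h w))).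
  rewrite /partition_function; apply: ler_sum => w lw.
  rewrite /G -!expRD ler_expR {1}/energy birkhoffD.
  have [Yr _] := repP lw; have Ys := shY m%:Z Yr.
  have := energy_dist m Yr; have := energy_dist n Ys.
  rewrite word_shift add0r !ler_norml => /andP[_ h1] /andP[_ h2] /=.
  by rewrite !mulrS mulr0n in h1 h2 *; lra.
rewrite -mulr_sumr ler_wpM2l ?expR_ge0 // -(big_imset _ h_inj) /=.
rewrite /partition_function big_distrlr /= pair_big /=.
rewrite big_mkcond [leRHS]big_mkcond /=; apply: ler_sum => p _.
case: ifPn => [/imsetP[w lw ->]|_].
  by have [-> ->] := hlegal w lw.
by case: ifP => _ //; rewrite /G mulr_ge0 ?expR_ge0.
Qed.

Lemma ln_partition_functionD m n :
  ln (partition_function (m + n)) <=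
  ln (partition_function m) + ln (partition_function n) + TV *+ 4.
Proof.
have Z0 := partition_function_gt0.
rewrite -lnM ?posrE // addrC -[X in X + _]expRK -lnM ?posrE ?expR_gt0 ?mulr_gt0 //.
by rewrite ler_ln ?posrE ?mulr_gt0 ?expR_gt0 //; exact: partition_functionD.
Qed.

Lemma avg_ln_partition_function_cvg :
  cvgn (avg (fun n => ln (partition_function n))).
Proof.
apply: (@fekete _ _ (sup_norm Y f) (TV *+ 4)) => [m n|n].
  exact: ln_partition_functionD.
rewrite -[leLHS]expRK ler_ln ?posrE ?expR_gt0 ?partition_function_gt0 //.
exact: partition_function_ge.
Qed.

Context (mu : probability (config A) R).
Hypotheses (mu_Y : measure_on Y mu) (mu_inv : shift_invariant mu).

Let mY : measurable Y. Proof. exact: closed_config_measurable HY.1. Qed.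

Lemma law_illegal n (u : {ffun 'I_n -> A}) : ~~ legal u -> law mu (word 0 n) u = 0.
Proof.
move=> nu; rewrite /law -(pr_setI_full mY) //; last exact: finite_valued_word.
rewrite (_ : _ `&` _ = set0) /pr ?measure0 //.
by apply/seteqP; split=> // x [Yx /= xu]; move: nu; rewrite -xu legal_word.
Qed.

Lemma continuous_measurable_on : measurable_fun Y f.
Proof.
have [cf _] := f_SV.
apply: (measurability _ (RGenOInfty.measurableE R)) => _ [_ [a ->] <-].
have oa : open [set x | a < x] by exact: open_gt.
have /continuousP/(_ _ oa)/open_subspaceP[W oW WY] := cf.
have -> : `]a, +oo[%classic = [set x | a < x].
  by apply/seteqP; split=> x /=; rewrite in_itv /= andbT.
rewrite setIC -WY; apply: measurableI => //; exact: open_config_measurable.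
Qed.

Lemma birkhoff_integrable n : mu.-integrable Y (EFin \o birkhoff f n).
Proof.
apply: (measurable_bounded_integrable mY).
- exact: (le_lt_trans (probability_le1 mu mY) (ltry _)).
- rewrite /birkhoff; apply: measurable_sum => i.
  apply: (measurable_comp mY _ continuous_measurable_on).
    by move=> _ [x Yx <-]; exact: shY.
  by apply: measurable_funTS; exact: shift_map_measurable.
exists (n%:R * sup_norm Y f); split; first exact: num_real.
by move=> M hM x Yx; apply: le_trans (ltW hM); exact: birkhoff_norm.
Qed.

Definition mean : R := \int[mu]_(x in Y) f x.

Lemma integral_shift a : \int[mu]_(x in Y) f (shift_map a x) = mean.
Proof.
have mS := @shift_map_measurable A a.
(* Y is invariant under both sigma^a and sigma^(-a), so extension by 0 commutes with the shift and
   the change of variables can be made on the whole space. *)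
pose g := f \_ Y; have gS : ((fun x => f (shift_map a x)) \_ Y) = g \o shift_map a.
  apply/funext => x; rewrite /g /= /patch.
  have -> // : (x \in Y) = (shift_map a x \in Y).
  apply/idP/idP; rewrite !inE; first exact: shY.
  by move=> /(shY (- a)); rewrite shift_mapD addNr shift_map0.
have mg : measurable_fun setT g.
  by apply/(measurable_restrict _ mY measurableT); rewrite setTI; exact: continuous_measurable_on.
rewrite /mean (Rintegral_mkcond mu Y f) (Rintegral_mkcond mu Y (fun x => f (shift_map a x))).
rewrite gS -/g /Rintegral; congr fine.
have mEg : measurable_fun setT (EFin \o g) by exact/measurable_EFinP.
have ig : mu.-integrable setT ((EFin \o g) \o shift_map a).
  apply: (measurable_bounded_integrable measurableT).
  - exact: (le_lt_trans (probability_le1 mu measurableT) (ltry _)).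
  - exact: (measurableT_comp mg mS).
  exists (sup_norm Y f); split; first exact: num_real.
  move=> M hM x _; apply: le_trans (ltW hM); rewrite /g /= /patch.
  case: ifP => [|_]; last by rewrite normr0 sup_norm_ge0.
  by rewrite inE => Yx; exact: norm_le_sup_norm.
have := @integral_pushforward _ _ _ _ _ _ mS mu setT _ mEg.
rewrite preimage_setT => /(_ ig measurableT) <-.
apply: eq_measure_integral => E mE _.
exact: shift_invariantE.
Qed.

Lemma integral_birkhoff n : \int[mu]_(x in Y) birkhoff f n x = n%:R * mean.
Proof.
have int1 a : mu.-integrable Y (EFin \o (fun x => f (shift_map a x))).
  apply: (measurable_bounded_integrable mY).
  - exact: (le_lt_trans (probability_le1 mu mY) (ltry _)).
  - apply: (measurable_comp mY _ continuous_measurable_on).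
      by move=> _ [x Yx <-]; exact: shY.
    by apply: measurable_funTS; exact: shift_map_measurable.
  exists (sup_norm Y f); split; first exact: num_real.
  move=> M hM x Yx; apply: le_trans (ltW hM).
  by apply: norm_le_sup_norm => //; exact: shY.
elim: n => [|n IH].
  under eq_Rintegral do rewrite /birkhoff big_ord0.
  by rewrite Rintegral_cst // !mul0r.
under eq_Rintegral do rewrite /birkhoff big_ord_recr /=.
rewrite (RintegralD mY (birkhoff_integrable n) (int1 n%:Z)) IH integral_shift.
by rewrite -[n.+1]addn1 natrD mulrDl mul1r.
Qed.

(** The energy of the word read on [0, n[ stays within 2 TV of the Birkhoff sum, whose integral is n
    times the mean. *)
Lemma mean_energy n :
  `|\sum_u law mu (word 0 n) u * energy u - n%:R * mean| <= TV *+ 2.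
Proof.
have [ie <-] := @Rintegral_finite_valued _ _ _ mu _ _ (@energy n) _
  (@finite_valued_word A 0 n) mY mu_Y.
rewrite -integral_birkhoff -RintegralB //; last exact: birkhoff_integrable.
have ig : mu.-integrable Y (EFin \o (fun x => energy (word 0 n x) - birkhoff f n x)).
  by apply: (eq_integrable mY _ _ _ (integrableB mY ie (birkhoff_integrable n))).
have icst (c : R) : mu.-integrable Y (EFin \o cst c).
  apply: (measurable_bounded_integrable mY) => //.
    exact: (le_lt_trans (probability_le1 mu mY) (ltry _)).
  exists `|c|; split; first exact: num_real.
  by move=> M hM x _; exact: ltW.
have dist x : Y x -> `|energy (word 0 n x) - birkhoff f n x| <= TV *+ 2.
  by move=> Yx; rewrite distrC; exact: energy_dist.
have cstE (c : R) : \int[mu]_(x in Y) c = c.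
  by rewrite Rintegral_cst // (_ : fine _ = 1) ?mulr1 //= mu_Y.
rewrite ler_norml; apply/andP; split.
  rewrite -[leLHS]cstE; apply: (le_Rintegral mY (icst _) ig) => x Yx.
  by have := dist x Yx; rewrite ler_norml => /andP[].
rewrite -[leRHS]cstE; apply: (le_Rintegral mY ig (icst _)) => x Yx.
by have := dist x Yx; rewrite ler_norml => /andP[].
Qed.

End Partition.

(** * Gibbs measures of words *)

(** The mass of E = psi(D) is the integral over D of the derivative, which is almost everywhere at
    least exp c. *)
Lemma gibbs_transfer (R : realType) (A : pointedFinType) (Y : set (config A))
    (phi : config A -> config A -> R) (nu : probability (config A) R)
    (D E : set (config A)) (psi : config A -> config A) (c : R) :
  gibbs_measure Y phi nu -> holonomy Y D E psi ->
  (forall x, D x -> c <= phi x (psi x)) -> expR c * pr nu D <= pr nu E.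
Proof.
move=> [_ _ gibbs] hol cphi; have [g [mg g0 gE] gphi] := gibbs _ _ _ hol.
have [[mD _] [mE _] [bij _] _ _] := hol.
have imE : psi @` D = E.
  by case: bij => fD _ sD; apply/seteqP; split=> [_ [x Dx <-]|y /sD//]; exact: fD.
rewrite -lee_fin EFinM -!prE // -imE gE //.
rewrite -(integral_cst nu mD (expR c)%:E).
apply: (ae_ge0_le_integral mD _ _ g0 mg).
- by move=> x _; rewrite lee_fin expR_ge0.
- exact: measurable_cst.
- by apply: filterS gphi => x gx Dx; rewrite gx // lee_fin ler_expR cphi.
Qed.

Section GibbsBound.
Context (R : realType) (A : pointedFinType) (Y : set (config A)).
Context (f : config A -> R) (HY : shift_space Y) (Y0 : Y !=set0).
Context (f_SV : summable_variation Y f).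
Notation TV := (total_variation Y f).
Notation B := (sup_norm Y f).

Let shY a x : Y x -> Y (shift_map a x). Proof. by move: HY => [_ +]; apply. Qed.
Let mY : measurable Y. Proof. exact: closed_config_measurable HY.1. Qed.

Lemma sub_word a b m n (x y : config A) : a <= b -> b + n%:Z <= a + m%:Z ->
  word a m x = word a m y -> word b n x = word b n y.
Proof.
move=> ab bnam /ffunP xy; apply/ffunP => i; rewrite !ffunE.
have lt : (absz (b + i%:Z - a)%R < m)%N by have := ltn_ord i; lia.
have := xy (Ordinal lt); rewrite !ffunE /=.
by have -> : a + (absz (b + i%:Z - a)%R)%:Z = b + i%:Z by lia.
Qed.

(** The range [-L, n + L[ consists of the n coordinates of the word, costing 2 TV, and of r + q = 2L
    others, costing the sup norm each. *)
Lemma birkhoff_window L n r y : Y y -> (r <= L.*2)%N ->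
  `|birkhoff f (n + L.*2) (shift_map (- L%:Z) y) -
    energy Y f (word (r%:Z - L%:Z) n y)| <= TV *+ 2 + L.*2%:R * B.
Proof.
move=> Yy rL; have [q qE] : exists q, (r + q)%N = L.*2 by exists (L.*2 - r)%N; lia.
have -> : (n + L.*2 = r + (n + q))%N by lia.
rewrite !birkhoffD !shift_mapD.
have Y1 := shY (- L%:Z) Yy; have Y2 := shY (r%:Z - L%:Z) Yy.
have Y3 := shY (n%:Z + (r%:Z - L%:Z)) Yy.
have := birkhoff_norm HY Y0 f_SV r Y1; have := birkhoff_norm HY Y0 f_SV q Y3.
have := energy_dist HY Y0 f_SV n Y2; rewrite word_shift add0r -qE natrD mulrDl.
by rewrite !ler_norml => /andP[? ?] /andP[? ?] /andP[? ?]; apply/andP; split; lra.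
Qed.

(** The domain on which the block U can be replaced by W within Y. The last condition makes the
    definition symmetric: the image is the set with U and W interchanged. *)
Definition exchange (a : int) m (U W : {ffun 'I_m -> A}) : set (config A) :=
  [set x | [/\ Y x, word a m x = U & Y (overwrite a W x)]].

Lemma exchange_measurable a m (U W : {ffun 'I_m -> A}) :
  measurable (exchange a U W).
Proof.
have -> : exchange a U W =
    Y `&` (word a m @^-1` [set U] `&` overwrite a W @^-1` Y).
  by apply/seteqP; split=> [x []|x [? []]].
apply: measurableI => //; apply: measurableI; first exact: finite_valued_word.
by apply: preimage_measurable => //; exact: overwrite_measurable.
Qed.

Lemma overwriteK a m (U W : {ffun 'I_m -> A}) x : word a m x = U ->
  overwrite a U (overwrite a W x) = x.
Proof. by move=> <-; apply: overwrite_eq => i iam; rewrite overwrite_out. Qed.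

Lemma exchange_holonomy a m (U W : {ffun 'I_m -> A}) :
  holonomy Y (exchange a U W) (exchange a W U) (overwrite a W).
Proof.
have fn U' W' x : exchange a U' W' x -> exchange a W' U' (overwrite a W' x).
  by case=> Yx xU Yw; split=> //; rewrite ?word_overwrite // overwriteK.
split.
- by split; [exact: exchange_measurable|move=> x []].
- by split; [exact: exchange_measurable|move=> x []].
- split; last by apply: measurable_funTS; exact: overwrite_measurable.
  split.
  + by move=> x; exact: fn.
  + move=> x y; rewrite !inE => -[_ xU _] [_ yU _] xy.
    by rewrite -(overwriteK W xU) xy overwriteK.
  + move=> y Ey; exists (overwrite a U y); first exact: fn.
    by case: Ey => _ yW _; rewrite overwriteK.
- exists (overwrite a U); split; first by move=> x [_ xU _]; rewrite overwriteK.
  by apply: measurable_funTS; exact: overwrite_measurable.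
- move=> x [Yx xU Yw]; split => //; exists (absz a + m).+1 => // i iN.
  by rewrite overwrite_out //; lia.
Qed.

Context (nu : probability (config A) R).
Hypotheses (nu_inv : shift_invariant nu).
Hypothesis (nu_gibbs : gibbs_measure Y (potential_cocycle f) nu).
Hypotheses (Y_sofic : sofic Y) (Y_irr : irreducible Y).

(** By [insert_config], every point of Y carrying u admits an exchange on [-L, n + L[ from a block U
    with u in the middle to a block W carrying v at some offset r. For each pair (U, r) the targets
    W are distinct words, and their total mass is at most the mass of v; the number of pairs is
    bounded independently of n. *)
Lemma gibbs_word_compare : exists2 C : R, 0 < C &
  forall n (u v : {ffun 'I_n -> A}), legal Y u -> legal Y v ->
  law nu (word 0 n) u <=
  C * expR (energy Y f u - energy Y f v) * law nu (word 0 n) v.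
Proof.
have [L LP] := insert_config Y_sofic Y_irr Y0.
pose c := TV *+ 2 + L.*2%:R * B.
pose Q := #|{: {ffun 'I_L -> A} * {ffun 'I_L -> A}}|.
(* Each exchange costs c for each of the two blocks and 2 TV for the tails of the cocycle. Q (2L +
   1) bounds the number of pairs (U, r); the successor makes positivity immediate. *)
exists (expR (c *+ 2 + TV *+ 2) * (Q * L.*2.+1).+1%:R).
  by rewrite mulr_gt0 ?expR_gt0.
move=> n u v lu lv; set a : int := - L%:Z; pose m := (n + L.*2)%N.
(* The word of length n at offset r of the block; for r <= 2L it stays inside the block, so the
   constant background is never read. *)
pose mid r (U : {ffun 'I_m -> A}) := word (r%:Z - L%:Z) n (overwrite a U (fun=> point)).
have midE r x : (r <= L.*2)%N -> mid r (word a m x) = word (r%:Z - L%:Z) n x.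
  move=> rL; apply: (@sub_word a _ m); rewrite /a /m; [lia|lia|].
  exact: word_overwrite.
have mid_word r : (r <= L.*2)%N -> mid r \o word a m = word (r%:Z - L%:Z) n.
  by move=> rL; apply/funext => x /=; exact: midE.
have bound U W r : (r <= L.*2)%N -> mid L U = u -> mid r W = v ->
    pr nu (exchange a U W) <=
    expR (c *+ 2 + TV *+ 2 + energy Y f u - energy Y f v) * law nu (word a m) W.
  move=> rL Uu Wv.
  have le1 : pr nu (exchange a W U) <= law nu (word a m) W.
    apply: pr_le; [exact: exchange_measurable|exact: finite_valued_word|].
    by move=> x [].
  apply: le_trans (ler_wpM2l (expR_ge0 _) le1).
  rewrite -ler_pdivrMl ?expR_gt0 // -expRN.
  apply: (gibbs_transfer nu_gibbs (exchange_holonomy a U W)).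
  move=> x [Yx xU Yw].
  have xu : word 0 n x = u by rewrite -Uu -xU midE ?subrr //; lia.
  have yv : word (r%:Z - L%:Z) n (overwrite a W x) = v.
    by rewrite -midE // word_overwrite.
  have := birkhoff_window n Yw rL; rewrite yv.
  have := @birkhoff_window L n L _ Yx ltac:(lia); rewrite subrr xu -/a -/m -/c.
  rewrite !ler_norml => /andP[_ h1] /andP[h2 _].
  have hc : energy Y f v - energy Y f u - c *+ 2 <=
      birkhoff f m (shift_map a (overwrite a W x)) - birkhoff f m (shift_map a x).
    by move: h1 h2; rewrite -/a -/m; lra.
  have := potential_cocycle_ge HY Y0 f_SV Yx Yw _ hc.
  move=> /(_ (fun i h => esym (overwrite_out W x h))).
  by lra.
pose I := ({ffun 'I_m -> A} * ('I_L.*2.+1 * {ffun 'I_m -> A}))%type.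
pose good (i : I) := (mid L i.1 == u) && (mid i.2.1 i.2.2 == v).
(* Unsuitable indices get the empty set, so that the cover is indexed by a whole finite type. *)
pose E (i : I) := if good i then exchange a i.1 i.2.2 else set0.
have cover : Y `&` word 0 n @^-1` [set u] `<=` \bigcup_i E i.
  move=> x [Yx /= xu]; have [Yv wv] := repP lv.
  have [W [Yw [r rL rv]]] := LP n x (rep Y v) Yx Yv.
  have rL' : (r < L.*2.+1)%N by [].
  exists (word a m x, (Ordinal rL', W)) => //; rewrite /E /good /=.
  have -> : mid L (word a m x) = u by rewrite midE ?subrr //; lia.
  have -> : mid r W = v by rewrite -(word_overwrite a W x) midE // rv wv.
  by rewrite !eqxx /=; split.
have mE i : measurable (E i).
  by rewrite /E; case: ifP => // _; exact: exchange_measurable.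
have mW : measurable (word 0 n @^-1` [set u] : set (config A)).
  exact: finite_valued_word.
have := pr_bigcup_le nu (measurableI _ _ mY mW) mE cover.
rewrite (pr_setI_full mY mW) => [|]; last by case: nu_gibbs.
rewrite -/(law nu (word 0 n) u).
set e := expR (c *+ 2 + TV *+ 2 + energy Y f u - energy Y f v) => main.
have sum_le : \sum_i pr nu (E i) <= e * (Q * L.*2.+1)%:R * law nu (word 0 n) v.
  apply: (@le_trans _ _ (\sum_(i : I | good i) e * law nu (word a m) i.2.2)).
    rewrite [leRHS]big_mkcond; apply: ler_sum => -[U [r W]] _.
    rewrite /E; case: ifPn => [/andP[/= /eqP Uu /eqP Wv]|_].
      by apply: (bound _ _ r); rewrite // -ltnS.
    by rewrite /pr measure0.
  rewrite -mulr_sumr -mulrA ler_wpM2l ?expR_ge0 //.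
  have -> : \sum_(i | good i) law nu (word a m) i.2.2 =
      \sum_(U | mid L U == u) \sum_(r < L.*2.+1) \sum_(W | mid r W == v) law nu (word a m) W.
    under [RHS]eq_bigr do rewrite pair_big_dep /=.
    by rewrite pair_big.
  rewrite sumr_const.
  have -> : \sum_(r < L.*2.+1) \sum_(W | mid r W == v) law nu (word a m) W =
      \sum_(r < L.*2.+1) law nu (word 0 n) v.
    apply: eq_bigr => r _; rewrite -law_comp; last exact: finite_valued_word.
    by rewrite mid_word -1?ltnS ?ltn_ord //; exact: law_word.
  rewrite sumr_const card_ord -mulrnA -[leLHS]mulr_natl.
  rewrite ler_wpM2r ?law_ge0 // ler_nat mulnC leq_mul //.
  (* A block U with middle u is determined by its two margins of length L, so there are at most Q of
     them. *)
  rewrite -(card_in_imset (f := fun U =>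
    (word a L (overwrite a U (fun=> point)), word n%:Z L (overwrite a U (fun=> point))))).
    exact: max_card.
  move=> U U' Uin U'in [/ffunP h1 /ffunP h2].
  have Uu : mid L U = u by apply/eqP; exact: Uin.
  have U'u : mid L U' = u by apply/eqP; exact: U'in.
  rewrite -(word_overwrite a U (fun=> point)) -(word_overwrite a U' (fun=> point)).
  apply/ffunP => i; rewrite !ffunE.
  case: (ltnP i L) => iL; first by have := h1 (Ordinal iL); rewrite !ffunE.
  have im : (i < n + L.*2)%N by exact: ltn_ord.
  case: (ltnP i (L + n)) => iLn.
    have lt : (i - L < n)%N by lia.
    have /ffunP/(_ (Ordinal lt)) : mid L U = mid L U' by rewrite Uu U'u.
    rewrite !ffunE /=.
    by have -> : L%:Z - L%:Z + (i - L)%N%:Z = a + i%:Z by rewrite /a; lia.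
  have lt : (i - (L + n) < L)%N by move: im iLn; clear; lia.
  have := h2 (Ordinal lt); rewrite !ffunE /=.
  by have -> : n%:Z + (i - (L + n))%N%:Z = a + i%:Z by rewrite /a; lia.
apply: (le_trans main); apply: (le_trans sum_le).
rewrite ler_wpM2r ?law_ge0 // /e -[X in expR X]addrA [X in X * _ <= _]expRD.
rewrite [leLHS]mulrAC ler_wpM2r ?expR_ge0 // ler_wpM2l ?expR_ge0 //.
by rewrite ler_nat.
Qed.

(** Multiply the comparison by exp of the energy of v and sum over v: the masses of the words v add
    up to at most 1. *)
Lemma gibbs_word_le : exists2 C : R, 0 < C &
  forall n (u : {ffun 'I_n -> A}), legal Y u ->
  law nu (word 0 n) u * partition_function Y f n <= C * expR (energy Y f u).
Proof.
have [C C0 CP] := gibbs_word_compare; exists C => // n u lu.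
rewrite /partition_function mulr_sumr.
apply: (@le_trans _ _ (\sum_(v | legal Y v)
    C * expR (energy Y f u) * law nu (word 0 n) v)).
  apply: ler_sum => v lv; rewrite -ler_pdivlMr ?expR_gt0 //.
  apply: le_trans (CP n u v lu lv) _; rewrite expRD expRN.
  by rewrite le_eqVlt; apply/orP; left; apply/eqP; ring.
rewrite -mulr_sumr -[leRHS]mulr1; apply: ler_wpM2l.
  by rewrite mulr_ge0 ?expR_ge0 // ltW.
rewrite -(sum_law nu (@finite_valued_word A 0 n)).
rewrite [leRHS](bigID (fun v => legal Y v)) /=.
by rewrite lerDl; apply: sumr_ge0 => v _; exact: law_ge0.
Qed.

End GibbsBound.

(** * Approximation of measurable partitions *)

Section Approximation.
Context (R : realType) (A : pointedFinType) (mu : probability (config A) R).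
Implicit Types (E G : set (config A)).

(** As [agree] is symmetric, one implication suffices to say that G depends only on the coordinates
    in [-N, N]. *)
Definition window_set N G : Prop := forall x y, agree N x y -> G x -> G y.

Lemma window_set_setC N G : window_set N G -> window_set N (~` G).
Proof. by move=> wG x y xy nGx Gy; apply: nGx; apply: wG Gy => n /xy. Qed.

Lemma window_set_measurable N G : window_set N G -> measurable G.
Proof.
move=> wG; apply: open_config_measurable; apply/open_agreeP => x Gx.
by exists N => y xy; exact: wG Gx.
Qed.

Definition approximable E : Prop := measurable E /\
  forall e : R, 0 < e -> exists N G, window_set N G /\ pr mu (E `+` G) <= e.

Lemma measurable_setY E G : measurable E -> measurable G -> measurable (E `+` G).
Proof. by move=> mE mG; apply: measurableU; exact: measurableD. Qed.

Lemma increasing_near (F : nat -> set (config A)) e : 0 < e ->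
  (forall n, measurable (F n)) -> {homo F : m n / (m <= n)%N >-> m `<=` n} ->
  exists n, pr mu (\bigcup_n F n `\` F n) <= e.
Proof.
move=> e0 mF incF; have mU : measurable (\bigcup_n F n) by exact: bigcup_measurable.
have cv : mu (F n) @[n --> \oo] --> mu (\bigcup_n F n).
  by apply: nondecreasing_cvg_mu => // m n mn; apply/subsetPset; exact: incF.
have {cv} cv : pr mu (F n) @[n --> \oo] --> pr mu (\bigcup_n F n).
  by apply: fine_cvg; rewrite -prE.
have [n _ nP] := (cvgrPdist_le _ _).1 cv _ e0.
exists n; have := nP n (leqnn n); apply: le_trans.
apply: le_trans (ler_norm _); rewrite lerBrDr.
have sub : F n `<=` \bigcup_n F n by exact: bigcup_sup.
rewrite -pr_setU; [|exact: measurableD|by []|].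
  by rewrite setUC setDUK.
by apply/seteqP; split => // x [[_ +] Fx]; apply.
Qed.

(** U is the increasing union of the sets [F n] of points whose whole window of radius n lies in
    U. *)
Lemma approximable_open U : open U -> approximable U.
Proof.
move=> oU; split; first exact: open_config_measurable.
move=> e e0; pose F n := [set x | forall y, agree n x y -> U y].
have wF n : window_set n (F n).
  by move=> x y xy Fx z yz; apply: Fx => i ni; rewrite xy // yz.
have FU : \bigcup_n F n = U.
  apply/seteqP; split=> [x [n _ Fx]|x Ux]; first exact: Fx.
  by have [n nU] := (open_agreeP U).1 oU x Ux; exists n.
have [||n nP] := increasing_near e0 (F := F).
- by move=> n; exact: window_set_measurable (wF n).
- by move=> m n mn x Fx y xy; apply: Fx => i im; apply: xy; exact: leq_trans im mn.
exists n, (F n); split => //; rewrite FU in nP.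
rewrite (_ : U `+` F n = U `\` F n) //; apply/seteqP; split=> x; last by left.
by case=> // -[Fx nU]; case: nU; exact: Fx.
Qed.

Lemma approximable_setC E : approximable E -> approximable (~` E).
Proof.
move=> [mE aE]; split; first exact: measurableC.
move=> e /aE[N [G [wG EG]]]; exists N, (~` G); split; first exact: window_set_setC.
rewrite (_ : _ `+` _ = E `+` G) //; apply/seteqP; split=> x.
  by case=> -[Ex Gx]; [right|left]; split => //; apply: contrapT.
by case=> -[Ex Gx]; [right|left]; split => // /(_ _).
Qed.

(** Half of the error goes to truncating the union to m terms, the other half is shared by these
    terms; dividing by m + 1 covers the case m = 0. *)
Lemma approximable_bigcup (E : nat -> set (config A)) :
  (forall n, approximable (E n)) -> approximable (\bigcup_n E n).
Proof.
move=> aE; have mE n : measurable (E n) by have [] := aE n.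
split; first exact: bigcup_measurable.
move=> e e0; pose F m := \bigcup_(i < m) E i.
have mF m : measurable (F m) by exact: bigcup_measurable.
have FE : \bigcup_m F m = \bigcup_n E n.
  apply/seteqP; split=> [x [m _ [i _ Eix]]|x [i _ Eix]]; first by exists i.
  by exists i.+1 => //; exists i => /=.
have e2 : 0 < e / 2 by lra.
have [//||m mP] := increasing_near e2 (F := F).
  by move=> m n mn x [i im Eix]; exists i => //=; exact: leq_trans im mn.
have em : 0 < e / 2 / m.+1%:R by rewrite divr_gt0.
have /choice[NG NGP] i : exists p : nat * set (config A),
    window_set p.1 p.2 /\ pr mu (E i `+` p.2) <= e / 2 / m.+1%:R.
  by have [_ /(_ _ em)[N [G [? ?]]]] := aE i; exists (N, G).
pose G := \bigcup_(i < m) (NG i).2.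
exists (\max_(i < m) (NG i).1), G; split.
  move=> x y xy [i im Gx]; exists i => //; apply: (NGP i).1 Gx => n nN.
  by apply: xy; apply: leq_trans nN _; exact: (leq_bigmax (Ordinal im)).
have mG i : measurable (NG i).2 by exact: window_set_measurable (NGP i).1.
have mGG : measurable G by exact: bigcup_measurable.
pose D (i : 'I_m) := E i `+` (NG i).2.
have mD i : measurable (D i) by exact: measurable_setY.
have mDU : measurable (\bigcup_i D i).
  by apply: fin_bigcup_measurable => //; exact: finite_finset.
have mEF : measurable (\bigcup_n F n `\` F m).
  by apply: measurableD => //; exact: bigcup_measurable.
have sub : \bigcup_n E n `+` G `<=` (\bigcup_n F n `\` F m) `|` \bigcup_i D i.
  move=> x; have [[i im Gix]|nGx] := pselect (G x).
    case=> [[_ nGx]|[_ nEx]]; first by case: nGx; exists i.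
    right; exists (Ordinal im) => //=; right; split => // Eix.
    by apply: nEx; exists i.
  case=> [[[i _ Eix] _]|[//]].
  have [[j jm Ejx]|nFx] := pselect (F m x).
    right; exists (Ordinal jm) => //=; left; split => // Gjx.
    by apply: nGx; exists j.
  by left; split => //; rewrite FE; exists i.
apply: (@le_trans _ _ (e / 2 + \sum_(i < m) e / 2 / m.+1%:R)).
  apply: le_trans (pr_le mu _ _ sub) _.
  - by apply: measurable_setY => //; exact: bigcup_measurable.
  - exact: measurableU.
  apply: le_trans (pr_setU_le mu mEF mDU) _; apply: lerD => //.
  apply: le_trans (pr_bigcup_le mu mDU mD (fun _ h => h)) _.
  by apply: ler_sum => i _; exact: (NGP i).2.
rewrite sumr_const card_ord -[X in _ + X]mulr_natl.
have : m%:R * (e / 2 / m.+1%:R) <= e / 2.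
  rewrite mulrA ler_pdivrMr // mulrC ler_wpM2l ?ler_nat //.
  by rewrite ltW.
by move=> h; rewrite [leRHS]splitr lerD2l.
Qed.

(** The approximable sets form a sigma-algebra that contains the open sets. *)
Lemma measurable_approximable E : measurable E -> approximable E.
Proof.
have : <<s @open (config A) >> `<=` [set E | approximable E].
  apply: smallest_sub; last by move=> U; exact: approximable_open.
  split; first exact/approximable_open/open0.
    by move=> D aD; rewrite setTD; exact: approximable_setC.
  by move=> F aF; exact: approximable_bigcup.
by apply.
Qed.

(** Each cell is approximated within e / k by a window set, and g picks a cell whose window set
    contains the word. Outside all the symmetric differences exactly one does, and it is the right
    one. *)
Lemma partition_approximation k (P : 'I_k -> set (config A)) (idx : config A -> 'I_k) (e : R) :
  0 < e -> (forall i, measurable (P i)) -> (forall i x, P i x <-> idx x = i) ->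
  exists N (g : {ffun 'I_(N.*2.+1) -> A} -> 'I_k),
    pr mu [set x | idx x <> g (word (- N%:Z) N.*2.+1 x)] <= e.
Proof.
move=> e0 mP Pidx; have k0 : (0 < k)%N by apply: leq_ltn_trans (ltn_ord (idx point)).
have ek : 0 < e / k%:R by rewrite divr_gt0 // ltr0n.
have /choice[NG NGP] i : exists p : nat * set (config A),
    window_set p.1 p.2 /\ pr mu (P i `+` p.2) <= e / k%:R.
  by have [_ /(_ _ ek)[N [G [? ?]]]] := measurable_approximable (mP i); exists (N, G).
pose N := \max_i (NG i).1.
(* Placing the word on a constant background gives a point at which window sets can be tested. *)
pose g (u : {ffun 'I_(N.*2.+1) -> A}) := odflt (Ordinal k0)
  [pick i | `[< (NG i).2 (overwrite (- N%:Z) u (fun=> point)) >]].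
exists N, g; set B := [set x | _].
have mD i : measurable (P i `+` (NG i).2).
  by apply: measurable_setY => //; exact: window_set_measurable (NGP i).1.
have mB : measurable B.
  have -> : B = \bigcup_i (P i `&` (g \o word (- N%:Z) N.*2.+1) @^-1` (~` [set i])).
    apply/seteqP; split=> [x Bx|x [i _ [/Pidx <-]]]; last by move=> /= h /esym.
    by exists (idx x) => //; split; [exact/Pidx|move=> /= /esym].
  apply: fin_bigcup_measurable; first exact: finite_finset.
  move=> i _; apply: measurableI => //; apply: finite_valued_preimage.
  by apply: finite_valued_comp; exact: finite_valued_word.
have sub : B `<=` \bigcup_i (P i `+` (NG i).2).
  move=> x Bx; apply: contrapT => nD; apply: Bx.
  have PG i : P i x <-> (NG i).2 x.
    split=> h; apply: contrapT => nh; apply: nD; exists i => //.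
      by left.
    by right.
  pose y := overwrite (- N%:Z) (word (- N%:Z) N.*2.+1 x) (fun=> point).
  have xy : agree N x y.
    move=> n nN; have [|j ->] := @overwrite_inside (- N%:Z) N.*2.+1 n; first by lia.
    by rewrite /y overwrite_in ffunE.
  have Gy i : `[< (NG i).2 y >] = (i == idx x).
    apply/asboolP/eqP => [Giy|->].
      apply/esym/Pidx/PG; apply: (NGP i).1 Giy => n nN; apply/esym/xy.
      by apply: leq_trans nN _; exact: leq_bigmax.
    have Gx : (NG (idx x)).2 x by apply/PG/Pidx.
    apply: (NGP _).1 Gx => n nN; apply/xy.
    by apply: leq_trans nN _; exact: leq_bigmax.
  rewrite /g -/y; case: pickP => [i|/(_ (idx x))]; rewrite Gy ?eqxx //.
  by move/eqP ->.
apply: le_trans (pr_le mu mB _ sub) _.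
  by apply: fin_bigcup_measurable => //; exact: finite_finset.
apply: le_trans (pr_bigcup_le mu _ mD (fun _ h => h)) _.
  by apply: fin_bigcup_measurable => //; exact: finite_finset.
apply: (@le_trans _ _ (\sum_(i < k) e / k%:R)).
  by apply: ler_sum => i _; exact: (NGP i).2.
by rewrite sumr_const card_ord -[leLHS]mulr_natl mulrC divfK // pnatr_eq0 -lt0n.
Qed.

End Approximation.

(** * The variational upper bound *)

Section Entropy.
Context d (T : measurableType d) (R : realType) (mu : probability T R).

Definition shannon (F : finType) (phi : T -> F) : R :=
  \sum_t - (law mu phi t * ln (law mu phi t)).

Lemma finite_valued_pair (F G : finType) (phi : T -> F) (psi : T -> G) :
  finite_valued phi -> finite_valued psi ->
  finite_valued (fun x => (phi x, psi x)).
Proof.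
move=> mphi mpsi [s t].
have -> : (fun x => (phi x, psi x)) @^-1` [set (s, t)] =
    phi @^-1` [set s] `&` psi @^-1` [set t].
  by apply/seteqP; split=> x /= [-> ->].
by apply: measurableI; [exact: mphi|exact: mpsi].
Qed.

Lemma law_le1 (F : finType) (phi : T -> F) t : finite_valued phi -> law mu phi t <= 1.
Proof. by move=> mphi; apply: pr_le1; exact: mphi. Qed.

Lemma shannon_ge0 (F : finType) (phi : T -> F) : finite_valued phi -> 0 <= shannon phi.
Proof.
move=> mphi; apply: sumr_ge0 => t _; rewrite -mulrN mulr_ge0 ?law_ge0 //.
by rewrite oppr_ge0 ln_le0 // law_le1.
Qed.

(** A value of [phi] is at most as likely as its image under g, so passing to [g \o phi] lowers the
    information - ln pointwise. *)
Lemma shannon_comp_le (F G : finType) (phi : T -> F) (g : F -> G) :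
  finite_valued phi -> shannon (g \o phi) <= shannon phi.
Proof.
move=> mphi; rewrite /shannon; under eq_bigr do rewrite -mulrN.
rewrite (expectation_comp mu g (fun s => - ln (law mu (g \o phi) s)) mphi).
apply: ler_sum => t _; rewrite -[leRHS]mulrN.
have [->|lt0] := eqVneq (law mu phi t) 0; first by rewrite !mul0r.
have l0 : 0 < law mu phi t by rewrite lt_def lt0 law_ge0.
rewrite ler_wpM2l ?law_ge0 // lerN2.
have le : law mu phi t <= law mu (g \o phi) (g t).
  apply: pr_le; [exact: mphi|exact: finite_valued_comp|].
  by move=> x /= ->.
by rewrite ler_ln ?posrE // (lt_le_trans l0).
Qed.

End Entropy.

Lemma finite_valued_index (A : pointedFinType) k (P : 'I_k -> set (config A))
    (idx : config A -> 'I_k) :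
  (forall i, measurable (P i)) -> (forall i x, P i x <-> idx x = i) ->
  finite_valued idx.
Proof.
move=> mP Pidx i; have -> : idx @^-1` [set i] = P i; last exact: mP.
by apply/seteqP; split=> x /= /Pidx.
Qed.

Lemma partition_index (T : Type) k (P : 'I_k -> set T) :
  partition setT P setT -> exists idx : T -> 'I_k, forall i x, P i x <-> idx x = i.
Proof.
case=> cov triv _.
have /choice[idx idxP] x : exists i, P i x.
  have : cover setT P x by rewrite cov.
  by case=> i _ Pix; exists i.
exists idx => i x; split=> [Pix|<-//].
by apply: (triv (idx x) i) => //; exists x.
Qed.

(** * Itineraries of a finite partition *)

Section Itineraries.
Context {A : pointedFinType} {k : nat} (idx : config A -> 'I_k).

Definition itinerary n (x : config A) : {ffun 'I_n -> 'I_k} :=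
  [ffun i : 'I_n => idx (shift_map i%:Z x)].

Lemma finite_valued_itinerary n : finite_valued idx -> finite_valued (itinerary n).
Proof.
move=> midx w.
have -> : itinerary n @^-1` [set w] =
    \bigcap_(i in [set: 'I_n]) (shift_map i%:Z @^-1` (idx @^-1` [set w i])).
  apply/seteqP; split=> [x /= xw i _ /=|x xw]; first by rewrite -xw ffunE.
  by apply/ffunP => i; rewrite ffunE; exact: (xw i I).
apply: fin_bigcap_measurable; first exact: finite_finset.
move=> i _; apply: preimage_measurable; last exact: midx.
exact: shift_map_measurable.
Qed.

Lemma join_entropyE (R : realType) (mu : probability (config A) R)
    (P : 'I_k -> set (config A)) n :
  (forall i x, P i x <-> idx x = i) ->
  join_entropy mu (shift_map 1) P n = shannon mu (itinerary n).
Proof.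
move=> Pidx; apply: eq_bigr => w _; rewrite /law /pr.
have -> // : [set x | forall i : 'I_n, P (w i) (iter i (shift_map 1) x)] =
  itinerary n @^-1` [set w].
apply/seteqP; split=> [x xw|x /= <- i].
  by apply/ffunP => i; rewrite ffunE -iter_shift; exact/Pidx.
by rewrite ffunE iter_shift; exact/Pidx.
Qed.

End Itineraries.

Section VariationalUpperBound.
Context (R : realType) (A : pointedFinType) (Y : set (config A)).
Context (f : config A -> R) (HY : shift_space Y) (Y0 : Y !=set0).
Context (f_SV : summable_variation Y f).
Notation TV := (total_variation Y f).
Notation Z := (partition_function Y f).
Context (mu : probability (config A) R).
Hypotheses (mu_Y : measure_on Y mu) (mu_inv : shift_invariant mu).

(* Gibbs' inequality against the weights exp(energy u) / Z for the word u on
   [-N, n + N[ and, given u, independent noise of level e around the itinerary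
   that u predicts. *)
Lemma shannon_itinerary_le k (idx : config A -> 'I_k) N
    (g : {ffun 'I_(N.*2.+1) -> A} -> 'I_k) (e : R) n :
  finite_valued idx -> 0 < e < 1 ->
  pr mu [set x | idx x <> g (word (- N%:Z) N.*2.+1 x)] <= e ->
  shannon mu (itinerary idx n) <=
  ln (Z (n + N.*2)) - (n + N.*2)%:R * mean Y f mu + TV *+ 2 +
  n%:R * (- ln (1 - e) - e * ln (e / k%:R)).
Proof.
move=> midx /andP[e0 e1] err.
have k0 : (0 < k)%N by apply: leq_ltn_trans (ltn_ord (idx point)).
have kR : 0 < k%:R :> R by rewrite ltr0n.
(* The cost [c a b] is minus the logarithm of the weight given to a when b is predicted: 1 - e for a
   = b, and e / k otherwise. These weights sum to at most 1 over a. *)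
pose c1 : R := - ln (1 - e); pose c2 : R := - ln (e / k%:R).
pose c (a b : 'I_k) : R := if a == b then c1 else c2.
have c1_ge0 : 0 <= c1 by rewrite oppr_ge0 ln_le0 //; lra.
have ek0 : 0 < e / k%:R by rewrite divr_gt0.
have ek1 : e / k%:R <= 1.
  by rewrite ler_pdivrMr // mul1r (le_trans (ltW e1)) // ler1n.
have c2_ge0 : 0 <= c2 by rewrite oppr_ge0 ln_le0.
have sumc b : \sum_a expR (- c a b) <= 1.
  rewrite (bigD1 b) //= {1}/c eqxx opprK lnK ?posrE; last by lra.
  apply: (@le_trans _ _ (1 - e + \sum_(a : 'I_k) e / k%:R)).
    rewrite lerD2l [leRHS](bigD1 b) //=; apply: le_trans (_ : _ <= \sum_(i < k | i != b) e / k%:R) _.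
      apply: ler_sum => a /negbTE ab; by rewrite /c ab opprK lnK ?posrE.
    by rewrite lerDr ltW.
  rewrite sumr_const card_ord -[X in _ + X]mulr_natl mulrC divfK ?gt_eqF //; last by lra.
pose m := (n + N.*2)%N.
pose V x := (itinerary idx n x, word (- N%:Z) m x : {ffun 'I_m -> A}).
have mV : finite_valued V.
  apply: finite_valued_pair; first exact: finite_valued_itinerary.
  exact: finite_valued_word.
pose guess (u : {ffun 'I_m -> A}) (i : 'I_n) :=
  g (word (i%:Z - N%:Z) N.*2.+1 (overwrite (- N%:Z) u (fun=> point))).
pose cost (t : {ffun 'I_n -> 'I_k} * {ffun 'I_m -> A}) : R :=
  \sum_(i < n) c (t.1 i) (guess t.2 i).
pose q (t : {ffun 'I_n -> 'I_k} * {ffun 'I_m -> A}) : R :=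
  if legal Y t.2 then expR (energy Y f t.2 - ln (Z m) - cost t) else 0.
have legalV t : law mu V t != 0 -> legal Y t.2.
  apply: contraNT => nl; rewrite eq_le law_ge0 andbT.
  rewrite -(law_illegal HY mu_Y nl) -(law_word (- N%:Z) 0 mu_inv).
  apply: pr_le; [exact: mV|exact: finite_valued_word|].
  by move=> x /= <-.
have q_ge0 t : 0 <= q t by rewrite /q; case: ifP => // _; exact: expR_ge0.
have Z0 := partition_function_gt0 HY Y0 f_SV m.
have sumq : \sum_t q t <= 1.
  rewrite -(pair_bigA _ (fun w u => q (w, u))) /= exchange_big /=.
  apply: (@le_trans _ _ (\sum_(u | legal Y u) expR (energy Y f u) / Z m)).
    rewrite [leRHS]big_mkcond; apply: ler_sum => u _; rewrite /q /=.
    case: ifP => lu; last by rewrite big1.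
    under eq_bigr do rewrite expRD expRD expRN lnK ?posrE //.
    rewrite -mulr_sumr -[leRHS]mulr1 ler_wpM2l //.
      by rewrite divr_ge0 ?expR_ge0 // ltW.
    rewrite /cost /=; under eq_bigr do rewrite -sumrN expR_sum.
    (* Given u, the noise is independent over the times i, so the sum over itineraries is a product
       of sums, each at most 1. *)
    rewrite -(bigA_distr_bigA (fun i a => expR (- c a (guess u i)))) /=.
    apply: prodr_ile1 => i _; rewrite sumc andbT.
    by apply: sumr_ge0 => a _; exact: expR_ge0.
  by rewrite -mulr_suml divff // gt_eqF.
apply: (@le_trans _ _ (shannon mu V)); first exact: (shannon_comp_le mu fst mV).
have := @gibbs_inequality _ _ (law mu V) q (law_ge0 mu V) q_ge0 _ (sum_law mu mV) sumq.
move=> /(_ _)/le_trans; apply.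
  by move=> t /legalV lt; rewrite /q lt expR_gt0.
have -> : \sum_t law mu V t * - ln (q t) =
    \sum_t law mu V t * (ln (Z m) - energy Y f t.2 + cost t).
  apply: eq_bigr => t _; have [->|nz] := eqVneq (law mu V t) 0; first by rewrite !mul0r.
  by congr (_ * _); rewrite /q (legalV t nz) expRK; ring.
under eq_bigr do rewrite mulrDr mulrBr.
rewrite big_split /= sumrB -mulr_suml (sum_law mu mV) mul1r.
have mean_le : (n + N.*2)%:R * mean Y f mu - TV *+ 2 <=
    \sum_t law mu V t * energy Y f t.2.
  rewrite -(expectation_comp mu snd (@energy _ _ Y f m) mV).
  under eq_bigr do rewrite (law_word (- N%:Z) 0 mu_inv).
  have := mean_energy HY Y0 f_SV mu_Y mu_inv m.
  by rewrite ler_norml => /andP[+ _]; rewrite -/m; lra.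
have cost_le : \sum_t law mu V t * cost t <= n%:R * (c1 + e * c2).
  rewrite /cost; under eq_bigr do rewrite mulr_sumr.
  rewrite exchange_big /= -[n in n%:R]card_ord -sum1_card natr_sum mulr_suml.
  apply: ler_sum => i _; rewrite mul1r.
  pose b (t : {ffun 'I_n -> 'I_k} * {ffun 'I_m -> A}) := t.1 i != guess t.2 i.
  pose b0 x := idx x != g (word (- N%:Z) N.*2.+1 x).
  (* A wrong prediction at time i is the event of a wrong prediction at time 0 pulled back by
     sigma^i; by invariance its probability is at most e for every i. *)
  have bV : b \o V = b0 \o shift_map i%:Z.
    apply/funext => x; rewrite /b /b0 /V /guess /= ffunE; congr (_ != g _).
    rewrite word_shift (addrC (- N%:Z)); apply: (@sub_word _ (- N%:Z) _ m).
    - by lia.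
    - by have := ltn_ord i; rewrite /m; lia.
    - exact: word_overwrite.
  have mb0 : finite_valued b0.
    exact: (finite_valued_comp (fun p => p.1 != g p.2)
      (finite_valued_pair midx (@finite_valued_word A (- N%:Z) N.*2.+1))).
  apply: (@le_trans _ _ (\sum_t law mu V t * (c1 + (b t)%:R * c2))).
    apply: ler_sum => t _; rewrite ler_wpM2l ?law_ge0 // /c /b.
    by case: eqP => _ /=; rewrite ?mul0r ?mul1r; lra.
  rewrite -(expectation_comp mu b (fun s : bool => c1 + s%:R * c2) mV) bV.
  rewrite big_bool /= !(law_shift _ mu_inv mb0) mul0r mul1r addr0.
  have := sum_law mu mb0; rewrite big_bool /=.
  have : law mu b0 true <= e.
    apply: le_trans err; rewrite /law le_eqVlt; apply/orP; left; apply/eqP.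
    by congr pr; apply/seteqP; split=> x /= /eqP.
  have := law_ge0 mu b0 true.
  by move: c2_ge0; set l := law mu b0 true; set l' := law mu b0 false => *; nra.
by rewrite -/m in mean_le *; move: mean_le cost_le; rewrite /c1 /c2 mulrN; lra.
Qed.

End VariationalUpperBound.

(** * Pressure and equilibrium *)

(** Take e = t^2 with t <= 1/2. Then - ln (1 - e) <= 2 t^2 <= t, and - ln t <= 1/t gives - e ln e <=
    2 t; with t^2 ln k the total is at most t (ln k + 3). *)
Lemma noise_cost_small (R : realType) (k : nat) (eps : R) : (0 < k)%N -> 0 < eps ->
  exists2 e : R, 0 < e < 1 & - ln (1 - e) - e * ln (e / k%:R) <= eps.
Proof.
move=> k0 eps0; have k1 : 1 <= k%:R :> R by rewrite ler1n.
have lnk : 0 <= ln (k%:R : R) by rewrite ln_ge0.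
have lnk3 : 0 < ln (k%:R : R) + 3 by lra.
pose t : R := Num.min (1 / 2) (eps / (ln k%:R + 3)).
have t0 : 0 < t by rewrite lt_min; apply/andP; split; [lra|exact: divr_gt0].
have t12 : t <= 1 / 2 by rewrite ge_min lexx.
have tk : t * (ln k%:R + 3) <= eps by rewrite -ler_pdivlMr // ge_min lexx orbT.
have tt : t * t <= 1 / 4 by nra.
have tt0 : 0 < t * t by rewrite mulr_gt0.
exists (t * t); first by apply/andP; split => //; lra.
have lnt : - ln t <= t^-1.
  rewrite -lnV ?posrE //; apply: le_trans (_ : _ <= ln (1 + t^-1)) _.
    by rewrite ler_ln ?posrE ?invr_gt0 ?addr_gt0 ?invr_gt0 // lerDr.
  by apply: le_ln1Dx; rewrite (lt_trans _ (_ : 0 < _)) ?invr_gt0.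
have ln1 : - ln (1 - t * t) <= 2 * (t * t).
  have d0 : 0 < 1 - t * t by lra.
  rewrite -lnV ?posrE //.
  have -> : (1 - t * t)^-1 = 1 + (t * t) / (1 - t * t) by field; lra.
  apply: le_trans (le_ln1Dx _) _.
    by rewrite (lt_trans _ (_ : 0 < _)) // divr_gt0.
  by rewrite ler_pdivrMr //; nra.
rewrite ln_div ?posrE // ?ltr0n // lnM ?posrE //.
have : t * t * - ln t <= t.
  apply: le_trans (ler_wpM2l (ltW tt0) lnt) _.
  by rewrite -mulrA divff ?mulr1 // gt_eqF.
have tt_le : t * t <= t * (1 / 2) by rewrite ler_wpM2l // ltW.
have := ler_wpM2r lnk tt_le; move: ln1 tk; set lk := ln k%:R; set lt := ln t.
by have : 0 <= t * lk by [rewrite mulr_ge0 // ltW]; lra.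
Qed.

Section Main.
Context (R : realType) (A : pointedFinType) (Y : set (config A)).
Context (f : config A -> R) (HY : shift_space Y) (Y0 : Y !=set0).
Context (f_SV : summable_variation Y f).
Notation TV := (total_variation Y f).
Notation Z := (partition_function Y f).

Let lnZ n := ln (Z n).
Let p := limn (avg lnZ).

Let lnZ_cvg : avg lnZ @ \oo --> p.
Proof. exact: (avg_ln_partition_function_cvg HY Y0 f_SV). Qed.

Lemma shannon_itinerary_upper (mu : probability (config A) R) k
    (P : 'I_k -> set (config A)) (idx : config A -> 'I_k) :
  measure_on Y mu -> shift_invariant mu ->
  (forall i, measurable (P i)) -> (forall i x, P i x <-> idx x = i) ->
  forall e, 0 < e -> exists K, forall n,
  shannon mu (itinerary idx n) <= lnZ n + n%:R * (- mean Y f mu + e) + K.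
Proof.
move=> mu_Y mu_inv mP Pidx e e0.
have k0 : (0 < k)%N by apply: leq_ltn_trans (ltn_ord (idx point)).
have [t t01 te] := noise_cost_small k0 e0.
have [|N [g err]] := partition_approximation mu (e := t) _ mP Pidx.
  by case/andP: t01.
(* Of the 6 TV, 2 come from the bound on the entropy and 4 from splitting ln Z_(n + 2N) into ln Z_n
   and ln Z_(2N). *)
exists (lnZ N.*2 + TV *+ 6 - N.*2%:R * mean Y f mu) => n.
have midx := finite_valued_index mP Pidx.
apply: le_trans (shannon_itinerary_le HY Y0 f_SV mu_Y mu_inv n midx t01 err) _.
have := ln_partition_functionD HY Y0 f_SV n N.*2; rewrite -/lnZ.
have := ler_wpM2l (ler0n R n) te.
rewrite -[(n + N.*2)%:R]/((n + N.*2)%:R) natrD !mulrS !mulr0n.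
by rewrite /lnZ; lra.
Qed.

Lemma integral_meanE (mu : probability (config A) R) : measure_on Y mu ->
  (\int[mu]_(x in Y) (f x)%:E)%E = (mean Y f mu)%:E.
Proof.
move=> mu_Y; rewrite /mean /Rintegral fineK //; apply: integrable_fin_num.
  exact: closed_config_measurable HY.1.
have := birkhoff_integrable HY Y0 f_SV mu 1.
have -> // : birkhoff f 1 = f.
by apply/funext => x; rewrite /birkhoff big_ord1 shift_map0.
Qed.

Lemma free_energy_le (mu : probability (config A) R) :
  measure_on Y mu -> shift_invariant mu -> (free_energy Y f mu <= p%:E)%E.
Proof.
move=> mu_Y mu_inv; rewrite /free_energy integral_meanE //.
rewrite -leeBrDr // -EFinB; apply: ge_ereal_sup => _ [k [P [[mP partP] ->]]].
rewrite lee_fin; have [idx Pidx] := partition_index partP.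
rewrite /partition_entropy; under eq_fun do rewrite (join_entropyE mu _ Pidx).
apply: (lim_avg_le lnZ_cvg).
  move=> n; apply: shannon_ge0; apply: finite_valued_itinerary.
  exact: finite_valued_index mP Pidx.
exact: shannon_itinerary_upper.
Qed.

(** The hypothesis bounds - ln of the mass of u below by ln Z_n - ln C - energy of u; average this
    over u. *)
Lemma shannon_word_ge (nu : probability (config A) R) (C : R) n : 0 < C ->
  measure_on Y nu -> shift_invariant nu ->
  (forall u : {ffun 'I_n -> A}, legal Y u ->
    law nu (word 0 n) u * Z n <= C * expR (energy Y f u)) ->
  lnZ n - n%:R * mean Y f nu - (ln C + TV *+ 2) <= shannon nu (word 0 n).
Proof.
move=> C0 nu_Y nu_inv nuC; have mw := @finite_valued_word A 0 n.
have Zn := partition_function_gt0 HY Y0 f_SV n.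
apply: (@le_trans _ _ (\sum_u law nu (word 0 n) u * (lnZ n - ln C - energy Y f u))).
  under eq_bigr do rewrite mulrBr.
  rewrite sumrB -mulr_suml (sum_law nu mw) mul1r.
  have := mean_energy HY Y0 f_SV nu_Y nu_inv n.
  by rewrite ler_norml => /andP[_]; lra.
apply: ler_sum => u _; rewrite -mulrN.
have [->|l0] := eqVneq (law nu (word 0 n) u) 0; first by rewrite !mul0r.
have lu : legal Y u by apply: contraNT l0 => /(law_illegal HY nu_Y) ->.
have lgt0 : 0 < law nu (word 0 n) u by rewrite lt_def l0 law_ge0.
rewrite ler_wpM2l ?law_ge0 //.
have := nuC u lu; rewrite -ler_ln ?posrE ?mulr_gt0 ?expR_gt0 //.
by rewrite !lnM ?posrE ?expR_gt0 // expRK /lnZ; lra.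
Qed.

Definition letter_cell (i : 'I_#|A|) : set (config A) := [set x | enum_rank (x 0) = i].

Lemma letter_cell_partition : measurable_partition letter_cell.
Proof.
have fv : finite_valued (fun x : config A => enum_rank (x 0)).
  move=> i; apply: open_config_measurable.
  have -> : (fun x : config A => enum_rank (x 0)) @^-1` [set i] =
      [set x | x 0 = enum_val i].
    by apply/seteqP; split=> x /= => [<-|->]; rewrite ?enum_rankK ?enum_valK.
  exact: coord_open.
split; first exact: fv.
split.
- by apply/seteqP; split => // x _; exists (enum_rank (x 0)).
- by move=> i j _ _ [x [/= <- <-]].
- by move=> i _; exists (fun=> enum_val i); rewrite /letter_cell /= enum_valK.
Qed.

(** The partition by the letter at 0 is shown to have entropy exactly p minus the mean. The lower
    bound comes from [gibbs_word_le]; the upper bound, valid for any partition, makes the averages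
    converge. *)
Lemma free_energy_gibbs_ge (nu : probability (config A) R) :
  sofic Y -> irreducible Y -> shift_invariant nu ->
  gibbs_measure Y (potential_cocycle f) nu -> (p%:E <= free_energy Y f nu)%E.
Proof.
move=> sY iY nu_inv nu_gibbs; have [nu_Y _ _] := nu_gibbs.
rewrite /free_energy integral_meanE // -leeBlDr // -EFinB.
apply: ereal_sup_ubound; exists #|A|, letter_cell; split.
  exact: letter_cell_partition.
pose idx (x : config A) : 'I_#|A| := enum_rank (x 0).
have Pidx i x : letter_cell i x <-> idx x = i by [].
have [mP _] := letter_cell_partition; have midx := finite_valued_index mP Pidx.
congr EFin; rewrite /partition_entropy.
under eq_fun do rewrite (join_entropyE nu _ Pidx).
apply/esym/cvg_lim => //; apply: (avg_cvg_squeeze lnZ_cvg).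
  exact: shannon_itinerary_upper.
have [C C0 CP] := gibbs_word_le HY Y0 f_SV nu_inv nu_gibbs sY iY.
exists (ln C + TV *+ 2) => n.
rewrite mulrN; apply: le_trans (shannon_word_ge C0 nu_Y nu_inv (CP n)) _.
(* The word on [0, n[ is a function of the itinerary, so its entropy is at most that of the
   itinerary. *)
pose g (w : {ffun 'I_n -> 'I_#|A|}) : {ffun 'I_n -> A} :=
  [ffun i => enum_val (w i)].
have -> : word 0 n = g \o itinerary idx n.
  apply/funext => x; apply/ffunP => i; rewrite !ffunE /= /idx enum_rankK.
  by rewrite /shift_map.

exact: (shannon_comp_le nu g (@finite_valued_itinerary A _ idx n midx)).
Qed.

End Main.

Theorem theorem4p11 (R : realType) (A : pointedFinType) (Y : set (config A))
    (f : config A -> R) (nu : probability (config A) R)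
    (Y_irreducible : irreducible Y) (Y_sofic : sofic Y)
    (f_SV : summable_variation Y f)
    (nu_invariant : shift_invariant nu)
    (nu_gibbs : gibbs_measure Y (potential_cocycle f) nu) :
  equilibrium_measure Y f nu.
Proof.
have [HY _] := Y_sofic; have [nu_Y _ _] := nu_gibbs.
have Y0 : Y !=set0.
  by apply/set0P/eqP => YE; move/eqP: nu_Y; rewrite YE measure0 eq_sym onee_eq0.
split => //; apply/le_anti/andP; split.
  by apply: ereal_sup_ubound; exists nu.
apply: ge_ereal_sup => _ [mu [mu_Y mu_inv] <-].
(* The limit p of ln Z_n / n lies between the two free energies. *)
apply: le_trans (free_energy_le HY Y0 f_SV mu_Y mu_inv) _.
exact: free_energy_gibbs_ge.
Qed.
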